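(* For all $k\ge 0$ and $r\ge 4$, the group $\tilde H_{k-1+r}(\mathsf{M}_{2k+1+3r};\mathbb{Z})$ contains a subgroup isomorphic to $(\mathbb{Z}_3)^{\binom{2k}{k}}$. For all $k\ge 0$, the group $\tilde H_{k+2}(\mathsf{M}_{2k+10};\mathbb{Z})$ contains a subgroup isomorphic to $(\mathbb{Z}_3)^{\binom{k+1}{\lfloor (k+1)/2\rfloor}}$. In particular, $\tilde H_{k-1+r}(\mathsf{M}_{2k+1+3r};\mathbb{Z})$ contains an element of order $3$ whenever $k\ge 0$ and $r\ge 3$.
   Context: $\mathsf{M}_n$ is the matching complex of the complete graph $K_n$ on vertex set $[n]=\{1,\dots,n\}$: the simplicial complex whose vertices are the edges of $K_n$ and whose faces are the matchings. $\tilde H$ denotes reduced simplicial homology. *)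

(* Defs.v *)
From HB Require Import structures.
From mathcomp Require Import all_boot all_order all_algebra.
From mathcomp Require Import boolp.

Set Implicit Arguments.
Unset Strict Implicit.
Unset Printing Implicit Defensive.

Import Order.TTheory GRing.Theory Num.Theory.
Local Open Scope ring_scope.

(* A finite abstract simplicial complex on V; the empty set is always a face,
   as needed for the augmented chain complex. *)
Record simplicial_complex (V : finType) := SimplicialComplex {
  faces :> {set {set V}};
  face_empty : set0 \in faces;
  face_subset : forall s t : {set V}, s \in faces -> t \subset s -> t \in faces
}.

Section Homology.
Variables (V : finType) (K : simplicial_complex V).

(* Faces are indexed by their number p of vertices, i.e. by dimension p - 1;
   p = 0 gives the empty face, hence the augmentation. *)
Definition face (p : nat) := {s : {set V} | (s \in faces K) && (#|s| == p)}.

Definition chain (p : nat) := {ffun face p -> int}.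

(* Coefficient of t in the boundary of s, where s is oriented by the order in
   which enum lists its vertices: the i-th facet (i >= 0) carries (-1)^i. *)
Definition incidence (t s : {set V}) : int :=
  \sum_(v in s | s :\ v == t)
     (-1) ^+ #|[set w in s | (enum_rank w < enum_rank v)%N]|.

Definition boundary (p : nat) (c : chain p.+1) : chain p :=
  [ffun t : face p => \sum_(s : face p.+1) incidence (val t) (val s) * c s].

Lemma boundary_is_zmod_morphism p : zmod_morphism (@boundary p).
Proof.
move=> a b; apply/ffunP => t; rewrite !ffunE -sumrB.
by apply: eq_bigr => s _; rewrite !ffunE mulrBr.
Qed.

HB.instance Definition _ p :=
  GRing.isZmodMorphism.Build (chain p.+1) (chain p) (@boundary p)
    (@boundary_is_zmod_morphism p).

Lemma boundary_boundary p (c : chain p.+2) : boundary (boundary c) = 0.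
Proof.
pose e (v : V) (s : {set V}) : int :=
  (-1) ^+ #|[set w in s | (enum_rank w < enum_rank v)%N]|.
have anti (s : {set V}) v w : v \in s -> w \in s -> v != w ->
    e w (s :\ v) * e v s = - (e v (s :\ w) * e w s).
  move=> vs ws; have rem (x y : V) : x \in s -> y \in s ->
      (enum_rank x < enum_rank y)%N ->
      e y (s :\ x) = - e y s /\ e x (s :\ y) = e x s.
    move=> xs ys xy; split; rewrite /e.
      rewrite [in RHS](cardsD1 x) !inE xs xy /= add1n exprS mulN1r opprK.
      by congr (_ ^+ _); apply: eq_card => z; rewrite !inE; rewrite andbA.
    congr (_ ^+ _); apply: eq_card => z; rewrite !inE.
    case: eqP => //= ->; rewrite ltnNge (ltnW xy) /=.
    by rewrite andbF.
  move=> vw; have [lt|lt|/ord_inj/enum_rank_inj eq] :=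
    ltngtP (enum_rank v) (enum_rank w).
  - by have [-> ->] := rem _ _ vs ws lt; rewrite mulNr mulrC.
  - by have [-> ->] := rem _ _ ws vs lt; rewrite mulNr opprK mulrC.
  - by rewrite eq eqxx in vw.
have key (r s : {set V}) : \sum_t incidence r t * incidence t s = 0.
  pose F v w : int := if [&& v \in s, w \in s, v != w & s :\ v :\ w == r]
                      then e w (s :\ v) * e v s else 0.
  have -> : \sum_t incidence r t * incidence t s = \sum_v \sum_w F v w.
    under eq_bigr => t _ do rewrite {2}/incidence mulr_sumr.
    rewrite (exchange_big_dep (mem s)) /=; last by move=> ? ? _ /andP[].
    rewrite big_mkcond; apply: eq_bigr => v _; case: ifP => vs; last first.
      by rewrite big1 // => w _; rewrite /F vs.
    under eq_bigl => t do rewrite vs eq_sym /=.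
    rewrite big_pred1_eq /incidence mulr_suml big_mkcond.
    apply: eq_bigr => w _; rewrite /F vs !inE eq_sym.
    by case: (v != w); case: (w \in s).
  have FN v w : F v w = - F w v.
    have sDC : s :\ w :\ v = s :\ v :\ w by rewrite !setDDl setUC.
    rewrite /F [w == v]eq_sym sDC [in RHS]andbCA.
    case: ifP => [/and4P[vs ws vw _]|_]; last by rewrite oppr0.
    exact: anti.
  apply/eqP; rewrite -eqNr -sumrN [X in _ == X]exchange_big; apply/eqP.
  by apply: eq_bigr => v _; rewrite -sumrN; apply: eq_bigr => w _; rewrite -FN.
apply/ffunP => r; rewrite !ffunE.
under eq_bigr => t _ do rewrite ffunE mulr_sumr.
rewrite exchange_big big1 //= => s _.
under eq_bigr => t _ do rewrite mulrA.
rewrite -mulr_suml; apply/eqP; rewrite mulf_eq0; apply/orP; left.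
apply/eqP; transitivity (\sum_t incidence (val r) t * incidence t (val s)) => //.
rewrite (bigID (fun t => (t \in faces K) && (#|t| == p.+1))) /=.
rewrite [X in _ = _ + X]big1 ?addr0; last first.
  move=> t; apply: contraNeq; rewrite mulf_eq0 negb_or => /andP[_].
  rewrite /incidence; apply: contraNT => tK; rewrite big_pred0 // => v.
  apply/negbTE; apply: contra tK => /andP[vs /eqP <-].
  have /andP[sK /eqP s2] := valP s; rewrite (face_subset sK) ?subD1set //=.
  by move: s2; rewrite (cardsD1 v) vs add1n => -[->].
rewrite [RHS](reindex_omap (val : face p.+1 -> _) insub) /=; last first.
  by move=> t tK; rewrite insubT.
by apply: eq_bigl => t; rewrite valK eqxx andbT; apply/esym/(valP t).
Qed.

Definition cycles (p : nat) : {pred chain p.+1} :=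
  fun c => boundary c == 0.

Lemma cycles_zmod_closed p : zmod_closed (@cycles p).
Proof.
split=> [|a b]; first by apply/eqP; rewrite raddf0.
by move=> /eqP a0 /eqP b0; apply/eqP; rewrite raddfB /= a0 b0 subrr.
Qed.

HB.instance Definition _ p :=
  GRing.isZmodClosed.Build (chain p.+1) (@cycles p) (@cycles_zmod_closed p).

Record cycle (d : nat) := Cycle {
  cycle_val :> chain d.+1;
  cycle_valP : cycle_val \in @cycles d
}.

HB.instance Definition _ d := [isSub for @cycle_val d].
HB.instance Definition _ d := [Choice of cycle d by <:].
HB.instance Definition _ d := [SubChoice_isSubZmodule of cycle d by <:].

Definition boundaries (d : nat) : {pred cycle d} :=
  fun z => `[< exists b : chain d.+2, boundary b = val z >].

Lemma boundaries_zmod_closed d : zmod_closed (@boundaries d).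
Proof.
split=> [|x y]; first by apply/asboolP; exists 0; rewrite !raddf0.
move=> /asboolP[b xb] /asboolP[c yc]; apply/asboolP; exists (b - c).
by rewrite !raddfB /= xb yc.
Qed.

HB.instance Definition _ d :=
  GRing.isZmodClosed.Build (cycle d) (@boundaries d) (@boundaries_zmod_closed d).

(* Reduced simplicial homology with integer coefficients in dimension d >= 0. *)
Definition reduced_homology (d : nat) : zmodType :=
  Quotient.quot (@boundaries d : zmodClosed (cycle d)).

End Homology.

Definition complete_edge (n : nat) := {e : {set 'I_n} | #|e| == 2%N}.

Definition is_matching n (m : {set complete_edge n}) : bool :=
  [forall e in m, forall f in m, (e != f) ==> [disjoint val e & val f]].

Definition matchings n : {set {set complete_edge n}} :=
  [set m | is_matching m].

Lemma matchings_empty n : set0 \in matchings n.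
Proof. by rewrite inE; apply/forall_inP => e; rewrite inE. Qed.

Lemma matchings_subset n (s t : {set complete_edge n}) :
  s \in matchings n -> t \subset s -> t \in matchings n.
Proof.
rewrite !inE => /forall_inP sM /subsetP ts.
apply/forall_inP => e /ts/sM/forall_inP eM.
by apply/forall_inP => f /ts/eM.
Qed.

Definition matching_complex (n : nat) : simplicial_complex (complete_edge n) :=
  SimplicialComplex (@matchings_empty n) (@matchings_subset n).

Definition contains_subgroup_isomorphic_to (G A : zmodType) : Prop :=
  exists (S : zmodClosed G) (f : {additive A -> G}),
    injective f /\ forall y : G, y \in S <-> exists x : A, y = f x.

Definition has_additive_order (G : zmodType) (x : G) (m : nat) : Prop :=
  [/\ (0 < m)%N, x *+ m = 0
    & forall j : nat, (0 < j < m)%N -> x *+ j <> 0].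

(* Main.v *)
From HB Require Import structures.
From mathcomp Require Import all_boot all_order all_algebra.
From mathcomp Require Import boolp zify.
Require Import Defs.

(* Write [abc] for the cycle ab - bc of the matching complex on {a, b, c}, and
   M(S) for the matching complex on a vertex set S.

   On 3r+1 vertices, the products [x1 x2 x3] ... [x_{3r-2} x_{3r-1} x_{3r}] with
   one spare vertex generate the cycles with r edges modulo boundaries.  For
   every r there is a functional on these cycles, with values in Z/3, that kills
   boundaries and takes each product to the sign of the vertex ordering (spare
   vertex last).  It is built by induction on r, summing the previous functional
   over the links of the edges at a fixed vertex; that 1 + 1 = -1 in Z/3 enters
   when the fixed vertex is the middle of a triple.  Thus products are nonzero
   modulo 3.  On the other hand, for r >= 2 every permutation of the 3r+1
   vertices changes a product by its sign up to a boundary, so that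
   [abc] + [cab] + [bca] = 0 shows that a product has order 3.

   To obtain many classes in dimension k + r - 1, join a product of r - 1 triples
   and a spare vertex with the fundamental cycles of the chessboard complexes
   R x (A - R), where |A| = 2k + 3 and R runs over the (k+1)-subsets of A
   avoiding two fixed vertices.  Taking links of edges inside A and applying the
   functional shows that these C(2k+1, k+1) classes are independent modulo 3;
   this number dominates both binomial coefficients of the theorem. *)

Set Implicit Arguments.
Unset Strict Implicit.
Unset Printing Implicit Defensive.

Import Order.TTheory GRing.Theory Num.Theory.
Local Open Scope ring_scope.

(** * Signed wedge and contraction operators *)

(** Chains are integer functions on all sets of edges, so joining an edge and taking its link are
    total operators with simple anticommutation relations; supports on vertex sets are separate
    predicates. To evaluate the functional, a cycle is first moved off a vertex by a choice that is
    not natural. The functionals on different vertex sets are thus unrelated a priori. Two of them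
    can be compared on cycles that use neither spare vertex: there products of triples generate
    modulo boundaries, and the normalisation on products determines both values. This comparison is
    what makes the inductive formula vanish on boundaries. Two vertices of A stay outside R because
    of the case |A| = 3: the three choices of R give, up to sign, the triples [abc], [cab], [bca],
    whose sum is 0, and fixing two vertices leaves just one of them. Proving order 3 takes two
    triples and a spare vertex, hence r - 1 >= 2. A class has (k+1) + (r-1) = k + r edges, which is
    dimension k + r - 1. *)

Section Grassmann.
Variable E : finType.
Implicit Types (e f : E) (t : {set E}).

Definition grass := {ffun {set E} -> int}.
Implicit Types c : grass.

(** The sign convention of [incidence], so that [bound] agrees with [boundary] on faces. *)
Definition gsign e t : int :=
  (-1) ^+ #|[set f in t | (enum_rank f < enum_rank e)%N]|.

(** [wedge] and [contract] are the creation and annihilation operators of the exterior algebra on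
    the edges; the lemmas below are their canonical anticommutation relations. *)
Definition wedge e c : grass :=
  [ffun t : {set E} => if e \in t then gsign e t * c (t :\ e) else 0].

Definition contract e c : grass :=
  [ffun t : {set E} => if e \in t then 0 else gsign e t * c (e |: t)].

Definition bound c : grass := \sum_e contract e c.

Lemma wedge_is_zmod_morphism e : zmod_morphism (wedge e).
Proof.
by move=> a b; apply/ffunP => t; rewrite !ffunE; case: ifP; rewrite ?subrr // mulrBr.
Qed.
HB.instance Definition _ e :=
  GRing.isZmodMorphism.Build grass grass (wedge e) (wedge_is_zmod_morphism e).

Lemma contract_is_zmod_morphism e : zmod_morphism (contract e).
Proof.
by move=> a b; apply/ffunP => t; rewrite !ffunE; case: ifP; rewrite ?subrr // mulrBr.
Qed.
HB.instance Definition _ e :=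
  GRing.isZmodMorphism.Build grass grass (contract e) (contract_is_zmod_morphism e).

Lemma bound_is_zmod_morphism : zmod_morphism bound.
Proof. by move=> a b; rewrite /bound -sumrB; apply: eq_bigr => e _; rewrite raddfB. Qed.
HB.instance Definition _ :=
  GRing.isZmodMorphism.Build grass grass bound bound_is_zmod_morphism.

Lemma gsignU e f t : f \notin t ->
  gsign e (f |: t) = (if (enum_rank f < enum_rank e)%N then -1 else 1) * gsign e t.
Proof.
move=> ft; rewrite /gsign; case: ifP => lt; last first.
  rewrite mul1r; congr (_ ^+ _); apply: eq_card => g; rewrite !inE.
  by case: (eqVneq g f) => [->|] //=; rewrite lt andbF.
rewrite -exprS; congr (_ ^+ _).
rewrite (cardsD1 f) !inE eqxx lt /=; congr _.+1.
apply: eq_card => g; rewrite !inE; case: (eqVneq g f) => [->|] //=.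
by rewrite (negPf ft).
Qed.

Lemma gsignD1 e t : gsign e (t :\ e) = gsign e t.
Proof.
congr (_ ^+ _); apply: eq_card => f; rewrite !inE.
by case: (eqVneq f e) => [->|] //=; rewrite ltnn andbF.
Qed.

Lemma gsignU1 e t : gsign e (e |: t) = gsign e t.
Proof.
rewrite -gsignD1 -[RHS]gsignD1; congr gsign; apply/setP => f; rewrite !inE.
by case: (eqVneq f e).
Qed.

Lemma gsignK e t : gsign e t * gsign e t = 1.
Proof. by rewrite -expr2 sqrr_sign. Qed.

Lemma gsign_swap e f t : e != f -> e \notin t -> f \notin t ->
  gsign e (f |: t) * gsign f t = - (gsign f (e |: t) * gsign e t).
Proof.
move=> ef et ft; rewrite !gsignU //.
have [lt|lt|/ord_inj/enum_rank_inj eq] := ltngtP (enum_rank e) (enum_rank f).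
- by rewrite mul1r mulN1r mulNr opprK mulrC.
- by rewrite mul1r mulN1r mulNr mulrC.
- by rewrite eq eqxx in ef.
Qed.

Lemma setD1C e f t : t :\ e :\ f = t :\ f :\ e.
Proof. by rewrite !setDDl setUC. Qed.

Lemma wedgeC e f c : wedge e (wedge f c) = - wedge f (wedge e c).
Proof.
apply/ffunP => t; rewrite !ffunE !inE.
have [->|ef] := eqVneq e f; first by rewrite /= mulr0 if_same oppr0.
rewrite /=; case: ifP => et; case: ifP => ft; rewrite ?mulr0 ?oppr0 //.
rewrite !mulrA setD1C -mulNr; congr (_ * _).
set u := t :\ f :\ e.
have eu : e \notin u by rewrite !inE eqxx.
have fu : f \notin u by rewrite !inE eqxx andbF.
have -> : t :\ e = f |: u.
  by rewrite /u setD1C setD1K // !inE eq_sym ef.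
have <- : e |: u = t :\ f by rewrite setD1K // !inE ef.
have -> : t = e |: (f |: u).
  by rewrite setUCA setD1K ?setD1K // !inE ef.
rewrite gsignU1 setUCA !gsignU1.
exact: gsign_swap.
Qed.

Lemma contractC e f c : contract e (contract f c) = - contract f (contract e c).
Proof.
apply/ffunP => t; rewrite !ffunE !inE.
have [->|ef] := eqVneq e f; first by rewrite /= mulr0 if_same oppr0.
rewrite /=.
case: ifP => et; case: ifP => ft; rewrite ?mulr0 ?oppr0 //.
rewrite !mulrA setUCA -mulNr; congr (_ * _).
by rewrite mulrC [in RHS]mulrC gsign_swap ?et ?ft // 1?eq_sym.
Qed.

Lemma contract_wedge e f c : e != f ->
  contract e (wedge f c) = - wedge f (contract e c).
Proof.
move=> ef; apply/ffunP => t; rewrite !ffunE !inE.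
rewrite [f == e]eq_sym (negPf ef) /=.
case: ifP => et; case: ifP => ft; rewrite ?mulr0 ?oppr0 //.
have -> : (e |: t) :\ f = e |: (t :\ f).
  apply/setP => g; rewrite !inE; case: (eqVneq g e) => [->|]; by rewrite ?ef.
rewrite !mulrA -mulNr; congr (_ * _).
have et' : e \notin t :\ f by rewrite !inE et andbF.
have ft' : f \notin t :\ f by rewrite !inE eqxx.
have -> : gsign e t = gsign e (f |: (t :\ f)) by rewrite setD1K.
have -> : gsign f (e |: t) = gsign f (e |: (t :\ f)).
  rewrite -gsignD1; congr gsign.
  apply/setP => g; rewrite !inE; case: (eqVneq g e) => [->|]; by rewrite ?ef.
rewrite -(gsignD1 f t).
by rewrite !gsignU //; case: (ltngtP (enum_rank e) (enum_rank f)) => [||/ord_inj/enum_rank_inj/eqP];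
   rewrite ?(negPf ef) // ?mul1r ?mulN1r ?opprK ?mulNr ?mulrN ?opprK // mulrC.
Qed.

Lemma contract_wedge_id e c : contract e (wedge e c) = c - wedge e (contract e c).
Proof.
apply/ffunP => t; rewrite !ffunE !inE eqxx /=.
case: ifP => et.
  by rewrite gsignD1 mulrA gsignK mul1r setD1K // subrr.
by rewrite -[X in _ * (X * _)]gsignD1 setU1K ?et // mulrA gsignK mul1r subr0.
Qed.

(** The cone formula: [wedge e] is a contracting homotopy. Every explicit filling below comes from
    it. *)
Lemma bound_wedge e c : bound (wedge e c) = c - wedge e (bound c).
Proof.
rewrite /bound raddf_sum (bigD1 e) //= [in RHS](bigD1 e) //= contract_wedge_id.
rewrite -[LHS]addrA; congr (_ + _); rewrite opprD; congr (_ + _).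
by rewrite -sumrN; apply: eq_bigr => f fe; rewrite contract_wedge.
Qed.

Lemma bound_contract e c : bound (contract e c) = - contract e (bound c).
Proof.
by rewrite /bound raddf_sum -sumrN; apply: eq_bigr => f _; rewrite contractC.
Qed.

Lemma bound_bound c : bound (bound c) = 0.
Proof.
suff H : bound (bound c) = - bound (bound c).
  apply/ffunP => t; have /ffunP/(_ t)/eqP := H.
  by rewrite [X in _ == X]ffunE eq_sym eqNr => /eqP ->; rewrite ffunE.
have -> : bound (bound c) = \sum_e \sum_f contract e (contract f c).
  by rewrite [LHS]/bound; apply: eq_bigr => e _; rewrite raddf_sum.
rewrite {1}exchange_big -sumrN /=; apply: eq_bigr => e _.
by rewrite -sumrN; apply: eq_bigr => f _; rewrite contractC.
Qed.

End Grassmann.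

(** * Chains of matchings supported on a vertex set *)

Section Matching.
Variable n : nat.
Notation V := 'I_n.
Notation E := (complete_edge n).
Notation Ch := (grass E).
Implicit Types (x y a b s : V) (S T : {set V}) (t : {set E}) (c : Ch) (p : nat).

Definition covered t : {set V} := \bigcup_(e in t) val e.

(** Indexed by vertices instead of edges; if [x = y] there is no edge, [insub] fails and the
    operator is 0. *)
Definition join_edge x y c : Ch := oapp (fun e : E => wedge e c) 0 (insub [set x; y]).
Definition link_edge x y c : Ch := oapp (fun e : E => contract e c) 0 (insub [set x; y]).

Lemma join_edge_is_zmod_morphism x y : zmod_morphism (join_edge x y).
Proof. by move=> c d; rewrite /join_edge; case: insubP => [e _ _|_] /=; rewrite ?raddfB ?subrr. Qed.
HB.instance Definition _ x y :=
  GRing.isZmodMorphism.Build Ch Ch (join_edge x y) (join_edge_is_zmod_morphism x y).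

Lemma link_edge_is_zmod_morphism x y : zmod_morphism (link_edge x y).
Proof. by move=> c d; rewrite /link_edge; case: insubP => [e _ _|_] /=; rewrite ?raddfB ?subrr. Qed.
HB.instance Definition _ x y :=
  GRing.isZmodMorphism.Build Ch Ch (link_edge x y) (link_edge_is_zmod_morphism x y).

Lemma join_edgeC x y : join_edge x y =1 join_edge y x.
Proof. by move=> c; rewrite /join_edge setUC. Qed.

Lemma link_edgeC x y : link_edge x y =1 link_edge y x.
Proof. by move=> c; rewrite /link_edge setUC. Qed.

Lemma edgeP x y : x != y ->
  exists e : E, [/\ val e = [set x; y], join_edge x y =1 wedge e & link_edge x y =1 contract e].
Proof.
move=> xy; have xy2 : #|[set x; y]| == 2%N by rewrite cards2 xy.
by exists (exist (fun e : {set V} => #|e| == 2%N) [set x; y] xy2); split => // c;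
  rewrite /join_edge /link_edge insubT.
Qed.

Lemma noedgeP x : (join_edge x x =1 fun=> 0) /\ (link_edge x x =1 fun=> 0).
Proof.
by split=> c; rewrite /join_edge /link_edge insubN // setUid cards1.
Qed.

Lemma edge_ends (e : E) : exists x y, x != y /\ val e = [set x; y].
Proof. by apply/cards2P; apply: (valP e). Qed.

Lemma join_edge_swap x y a b c :
  join_edge x y (join_edge a b c) = - join_edge a b (join_edge x y c).
Proof.
have [->|xy] := eqVneq x y; first by rewrite !(noedgeP _).1 raddf0 oppr0.
have [->|ab] := eqVneq a b; first by rewrite !(noedgeP _).1 raddf0 oppr0.
have [e [_ we _]] := edgeP xy; have [f [_ wf _]] := edgeP ab.
by rewrite !we !wf wedgeC.
Qed.

Lemma link_edge_join x y a b c : [set x; y] != [set a; b] ->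
  link_edge x y (join_edge a b c) = - join_edge a b (link_edge x y c).
Proof.
have [->|xy] := eqVneq x y; first by rewrite !(noedgeP _).2 raddf0 oppr0.
have [->|ab] := eqVneq a b; first by rewrite !(noedgeP _).1 raddf0 oppr0.
have [e [ve _ ie]] := edgeP xy; have [f [vf wf _]] := edgeP ab.
move=> ef; rewrite !ie !wf contract_wedge //.
by apply: contraNneq ef => eqef; rewrite -ve -vf eqef.
Qed.

Lemma link_edge_join_id x y c : x != y ->
  link_edge x y (join_edge x y c) = c - join_edge x y (link_edge x y c).
Proof.
by move=> /edgeP[e [_ we ie]]; rewrite !we !ie contract_wedge_id.
Qed.

Lemma bound_join x y c : x != y ->
  bound (join_edge x y c) = c - join_edge x y (bound c).
Proof. by move=> /edgeP[e [_ we ie]]; rewrite !we bound_wedge. Qed.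

Lemma bound_link x y c : bound (link_edge x y c) = - link_edge x y (bound c).
Proof.
have [->|/edgeP[e [_ we ie]]] := eqVneq x y; first by rewrite !(noedgeP _).2 raddf0 oppr0.
by rewrite !ie bound_contract.
Qed.

(** [p] counts edges, so these are the chains of dimension [p - 1] of the matching complex on
    [S]. *)
Definition chains_on S p : {pred Ch} := fun c =>
  [forall t, (c t != 0) ==> [&& t \in matchings n, #|t| == p & covered t \subset S]].

Lemma chains_onP S p c :
  reflect (forall t, c t != 0 -> [/\ t \in matchings n, #|t| = p & covered t \subset S])
          (c \in chains_on S p).
Proof.
apply: (iffP forallP) => H t.
  by move/implyP: (H t) => {}H /H/and3P[? /eqP].
by apply/implyP => /H[-> -> ->]; rewrite eqxx.
Qed.

Lemma chains_on_zmod_closed S p : zmod_closed (chains_on S p).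
Proof.
split=> [|a b /chains_onP Ha /chains_onP Hb]; apply/chains_onP => t.
  by rewrite ffunE eqxx.
rewrite !ffunE; have [a0|/Ha//] := eqVneq (a t) 0.
by rewrite a0 sub0r oppr_eq0 => /Hb.
Qed.
HB.instance Definition _ S p :=
  GRing.isZmodClosed.Build Ch (chains_on S p) (chains_on_zmod_closed S p).

Lemma matching_setU1 e t : e \notin t ->
  (e |: t \in matchings n) = (t \in matchings n) && [disjoint val e & covered t].
Proof.
move=> et; apply/idP/andP => [etM|[tM eD]].
  split; first by apply: matchings_subset etM _; apply: subsetUr.
  apply/bigcup_disjointP => f ft.
  move: etM; rewrite inE => /forall_inP/(_ e (setU11 _ _))/forall_inP/(_ f).
  rewrite inE ft orbT => /(_ isT)/implyP; apply.
  by apply: contraNneq et => ->.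
rewrite inE; apply/forall_inP => f; rewrite in_setU1 => /predU1P fE.
apply/forall_inP => g; rewrite in_setU1 => /predU1P gE; apply/implyP => fg.
have D h : h \in t -> [disjoint val e & val h].
  by move=> ht; apply: disjointWr eD; apply: bigcup_sup.
case: fE gE fg => [->|ft] [->|gt]; rewrite ?eqxx // => fg; first exact: D.
  by rewrite disjoint_sym D.
by move: tM; rewrite inE => /forall_inP/(_ _ ft)/forall_inP/(_ _ gt)/implyP; apply.
Qed.

Lemma covered_setU1 e t : covered (e |: t) = val e :|: covered t.
Proof.
have [et|et] := boolP (e \in t); last by rewrite /covered big_setU1.
by rewrite (setUidPr _) ?sub1set // (setUidPr _) // bigcup_sup.
Qed.

Lemma chains_on_sub S S' p c : S \subset S' -> c \in chains_on S p -> c \in chains_on S' p.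
Proof.
move=> SS' /chains_onP H; apply/chains_onP => t /H[? ? tS]; split=> //.
exact: subset_trans SS'.
Qed.

Lemma join_chains S S' p x y c : c \in chains_on S p -> x \notin S -> y \notin S ->
  x |: (y |: S) \subset S' -> join_edge x y c \in chains_on S' p.+1.
Proof.
move=> /chains_onP H xS yS SS'.
have [->|/edgeP[e [ve we _]]] := eqVneq x y; first by rewrite (noedgeP _).1 rpred0.
rewrite we; apply/chains_onP => t; rewrite ffunE; case: ifP => [et|]; last by rewrite eqxx.
rewrite mulf_eq0 negb_or => /andP[_ /H[tM tp tS]].
rewrite -(setD1K et) cardsU1 matching_setU1 ?setD11 // tM tp covered_setU1 ve.
split=> //.
  apply/pred0P => z /=; apply/negbTE/andP => -[]; rewrite !inE => zxy /(subsetP tS).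
  by case/orP: zxy => /eqP->; apply/negP.
apply: subset_trans SS'; rewrite setUA; exact: setUS.
Qed.

Lemma link_chains S p x y c : c \in chains_on S p.+1 ->
  link_edge x y c \in chains_on (S :\ x :\ y) p.
Proof.
move=> /chains_onP H.
have [->|/edgeP[e [ve _ ie]]] := eqVneq x y; first by rewrite (noedgeP _).2 rpred0.
rewrite ie; apply/chains_onP => t; rewrite ffunE; case: ifP => [|/negbT et]; first by rewrite eqxx.
rewrite mulf_eq0 negb_or => /andP[_ /H[]].
rewrite matching_setU1 // cardsU1 et add1n covered_setU1 => /andP[-> eD] [->];
  rewrite subUset => /andP[_ tS].
split=> //; apply/subsetP => z zt; rewrite !inE (subsetP tS) // andbT.
move: eD; rewrite ve disjoint_sym => /pred0P/(_ z); rewrite /= zt !inE /=.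
by case: (z == y); case: (z == x).
Qed.

Lemma link0_chains S p x y c : c \in chains_on S p -> x \notin S -> link_edge x y c = 0.
Proof.
move=> /chains_onP H xS.
have [->|/edgeP[e [ve _ ie]]] := eqVneq x y; first by rewrite (noedgeP _).2.
rewrite ie; apply/ffunP => t; rewrite !ffunE; case: ifP => // et.
apply/eqP; rewrite mulf_eq0; apply/orP; right; apply: contraNT xS => /H[_ _ /subsetP]; apply.
by rewrite covered_setU1 ve !inE eqxx.
Qed.

Lemma link00_chains S x y c : c \in chains_on S 0 -> link_edge x y c = 0.
Proof.
move=> /chains_onP H.
have [->|/edgeP[e [ve _ ie]]] := eqVneq x y; first by rewrite (noedgeP _).2.
rewrite ie; apply/ffunP => t; rewrite !ffunE; case: ifP => // et.
apply/eqP; rewrite mulf_eq0; apply/orP; right; apply/negP => /negP/H[_ /eqP].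
by rewrite cardsU1 et.
Qed.

Lemma chains_on0 S S' c : c \in chains_on S 0 -> c \in chains_on S' 0.
Proof.
move=> /chains_onP H; apply/chains_onP => t /H[? t0 _]; split=> //.
by rewrite (cards0_eq t0) /covered big_set0 sub0set.
Qed.

Lemma bound_chains S p c : c \in chains_on S p.+1 -> bound c \in chains_on S p.
Proof.
move=> H; rewrite /bound rpred_sum // => e _.
have [x [y [xy ve]]] := edge_ends e.
have [f [vf _ ie]] := edgeP xy.
have <- : f = e by apply: val_inj; rewrite vf.
rewrite -ie; apply: chains_on_sub (link_chains _ _ H).
exact: subset_trans (subsetDl _ _) (subsetDl _ _).
Qed.

(** In a matching at most one edge contains [s]; the sum collects exactly the matchings that cover
    [s]. *)
Lemma chains_on_split S p s c : c \in chains_on S p ->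
  c - \sum_(a in S :\ s) join_edge a s (link_edge a s c) \in chains_on (S :\ s) p.
Proof.
move=> /chains_onP H; apply/chains_onP => t; rewrite !ffunE sum_ffunE.
have JL a : a \in S :\ s -> join_edge a s (link_edge a s c) t =
    if [exists e in t, val e == [set a; s]] then c t else 0.
  rewrite !inE => /andP[as_ _]; have [e [ve we ie]] := edgeP as_.
  rewrite we ie ffunE; case: ifP => et.
    rewrite ffunE setD11 gsignD1 mulrA gsignK mul1r setD1K //.
    by case: ifP => // /exists_inP[]; exists e; rewrite ?ve.
  case: ifP => // /exists_inP[f ft /eqP vf].
  by have fe : f = e; [apply: val_inj; rewrite vf ve | rewrite -fe ft in et].
rewrite (eq_bigr _ JL) -big_mkcondr /=.
have [->|ct0] := eqVneq (c t) 0; first by rewrite big1 // subrr eqxx.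
have [tM tp tS] := H _ ct0.
have [/bigcupP[e et se]|st] := boolP (s \in covered t); last first.
  rewrite big_pred0; last first.
    move=> a; apply/negbTE/negP => /andP[_ /exists_inP[e et /eqP ve]].
    by case/negP: st; apply/bigcupP; exists e; rewrite // (ve : val e = _) !inE eqxx orbT.
  by split=> //; rewrite subsetD1 tS.
have [x [y [xy ve]]] := edge_ends e.
have [a as_ {}ve] : exists2 a, a != s & val e = [set a; s].
  move: se; rewrite ve !inE => /orP[] /eqP ->; first by exists y; rewrite 1?eq_sym // setUC.
  by exists x.
rewrite (big_pred1 a) ?subrr ?eqxx // => b /=;
  apply/andP/eqP => [[bS /exists_inP[f ft /eqP vf]]|->].
  have fe : f = e.
    apply/eqP/negPn/negP => fe; move: tM; rewrite inE.
    move=> /forall_inP/(_ _ ft)/forall_inP/(_ _ et)/implyP/(_ fe)/pred0P/(_ s).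
    by rewrite /= (vf : val f = _) ve !inE eqxx !orbT.
  have : b \in [set a; s] by rewrite -ve -fe (vf : val f = _) !inE eqxx.
  by move: bS; rewrite !inE => /andP[/negPf ->]; rewrite orbF => _ /eqP.
split; last by apply/exists_inP; exists e; rewrite ?ve.
by rewrite !inE as_ (subsetP tS) //; apply/bigcupP; exists e; rewrite // ve !inE eqxx.
Qed.

Definition cycles_on S p : {pred Ch} := fun c => (c \in chains_on S p) && (bound c == 0).

Lemma cycles_on_zmod_closed S p : zmod_closed (cycles_on S p).
Proof.
split=> [|a b /andP[Sa /eqP a0] /andP[Sb /eqP b0]]; apply/andP.
  by rewrite rpred0 raddf0.
by rewrite rpredB // raddfB /= a0 b0 subrr.
Qed.
HB.instance Definition _ S p :=
  GRing.isZmodClosed.Build Ch (cycles_on S p) (cycles_on_zmod_closed S p).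

Lemma cycles_onP S p c : reflect (c \in chains_on S p /\ bound c = 0) (c \in cycles_on S p).
Proof. by apply: (iffP andP) => -[cS /eqP]. Qed.

Definition bounds_on S p : {pred Ch} := fun c =>
  `[< exists2 b, b \in chains_on S p.+1 & bound b = c >].

Lemma bounds_onP S p c :
  reflect (exists2 b, b \in chains_on S p.+1 & bound b = c) (c \in bounds_on S p).
Proof. exact: asboolP. Qed.

Lemma bounds_on_zmod_closed S p : zmod_closed (bounds_on S p).
Proof.
split=> [|a b /bounds_onP[d dS <-] /bounds_onP[e eS <-]]; apply/bounds_onP.
  by exists 0; rewrite ?rpred0 ?raddf0.
by exists (d - e); rewrite ?rpredB ?raddfB.
Qed.
HB.instance Definition _ S p :=
  GRing.isZmodClosed.Build Ch (bounds_on S p) (bounds_on_zmod_closed S p).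

Lemma bounds_cycles S p c : c \in bounds_on S p -> c \in cycles_on S p.
Proof.
move=> /bounds_onP[b bS <-]; apply/cycles_onP; split; first exact: bound_chains.
exact: bound_bound.
Qed.

Lemma cycles_on_sub S S' p c : S \subset S' -> c \in cycles_on S p -> c \in cycles_on S' p.
Proof. by move=> SS' /cycles_onP[cS c0]; apply/cycles_onP; rewrite (chains_on_sub SS'). Qed.

Lemma bounds_on_sub S S' p c : S \subset S' -> c \in bounds_on S p -> c \in bounds_on S' p.
Proof. by move=> SS' /bounds_onP[b bS bE]; apply/bounds_onP; exists b;
  rewrite // (chains_on_sub SS'). Qed.

Lemma link_cycles S p x y c : c \in cycles_on S p.+1 ->
  link_edge x y c \in cycles_on (S :\ x :\ y) p.
Proof.
move=> /cycles_onP[cS c0]; apply/cycles_onP; split; first exact: link_chains.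
by rewrite bound_link c0 raddf0 oppr0.
Qed.

Lemma cone_bounds S S' p x y c : c \in cycles_on S p -> x != y -> x \notin S -> y \notin S ->
  x |: (y |: S) \subset S' -> c \in bounds_on S' p.
Proof.
move=> /cycles_onP[cS c0] xy xS yS SS'; apply/bounds_onP; exists (join_edge x y c).
  exact: join_chains cS xS yS SS'.
by rewrite bound_join // c0 raddf0 subr0.
Qed.

(** If the link of the edge [a s] is the boundary of [d a], then joining [a s] to that link gives
    [d a] up to a boundary, by the cone formula, and [d a] avoids [s]. *)
Lemma push_off S p s c : s \in S -> c \in cycles_on S p.+1 ->
  (forall a, a \in S :\ s -> link_edge a s c \in bounds_on (S :\ a :\ s) p) ->
  exists2 b, b \in bounds_on S p.+1 & c - b \in cycles_on (S :\ s) p.+1.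
Proof.
move=> sS cC Hl; have [cS c0] := cycles_onP _ _ _ cC.
have /choice[d Hd] a : exists d, a \in S :\ s ->
    d \in chains_on (S :\ a :\ s) p.+1 /\ bound d = link_edge a s c.
  have [/Hl/bounds_onP[d dS dE]|_] := boolP (a \in S :\ s); last by exists 0.
  by exists d.
pose b := - \sum_(a in S :\ s) join_edge a s (d a).
have bS : b \in chains_on S p.+2.
  rewrite rpredN rpred_sum // => a aS; have [dS _] := Hd a aS.
  apply: join_chains dS _ _ _; rewrite ?inE ?eqxx ?andbF //.
  apply/subsetP => z; rewrite !inE; case/or3P => [/eqP->|/eqP->|/and3P[]//] //.
  by move: aS; rewrite !inE => /andP[].
exists (bound b); first by apply/bounds_onP; exists b.
apply/cycles_onP; rewrite raddfB /= bound_bound c0 subrr; split=> //.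
have -> : c - bound b = c - \sum_(a in S :\ s) join_edge a s (link_edge a s c)
                        + \sum_(a in S :\ s) d a.
  rewrite -addrA; congr (_ + _); rewrite raddfN opprK raddf_sum /= [RHS]addrC -sumrB.
  apply: eq_bigr => a aS; have [_ <-] := Hd a aS.
  by rewrite bound_join //; move: aS; rewrite !inE => /andP[].
rewrite rpredD ?chains_on_split // rpred_sum // => a aS; have [dS _] := Hd a aS.
by apply: chains_on_sub dS; apply/setSD/subsetDl.
Qed.

(** The classical vanishing range of matching complexes. By induction the links bound, so the cycle
    can be pushed off two vertices [x] and [y] in turn; the edge [x y] then cones it off. *)
Lemma connectivity S p c : (3 * p + 2 <= #|S|)%N -> c \in cycles_on S p -> c \in bounds_on S p.
Proof.
elim: p S c => [|p IH] S c Scard cC.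
  have /card_gt1P[x [y [xS yS xy]]] : (1 < #|S|)%N by [].
  apply: (@cone_bounds set0 S 0 x y); rewrite ?inE //.
    by have [cS c0] := cycles_onP _ _ _ cC; apply/cycles_onP; split=> //; apply: chains_on0 cS.
  by rewrite setU0 subUset !sub1set xS yS.
have push T d s : (3 * p + 4 <= #|T|)%N -> s \in T -> d \in cycles_on T p.+1 ->
    exists2 b, b \in bounds_on T p.+1 & d - b \in cycles_on (T :\ s) p.+1.
  move=> Tcard sT dC; apply: push_off => // a aT; apply: IH; last exact: link_cycles.
  have aT' : a \in T by move: aT; rewrite !inE => /andP[].
  have := cardsD1 s (T :\ a); have := cardsD1 a T; rewrite aT'.
  have -> : s \in T :\ a by move: aT; rewrite !inE eq_sym sT => /andP[->].
  by rewrite !add1n => e1 e2; move: Tcard; rewrite e1 e2; move: {e1 e2} (#|_|) => m; lia.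
have /card_gt1P[x [y [xS yS xy]]] : (1 < #|S|)%N.
  by lia.
have Sc4 : (3 * p + 4 <= #|S :\ x|)%N.
  by move: Scard; rewrite (cardsD1 x) xS; lia.
have [b bB cbC] := push S c x (leq_trans Sc4 (subset_leq_card (subsetDl _ _))) xS cC.
have yS' : y \in S :\ x by rewrite !inE eq_sym xy.
have [b' b'B cb'C] := push (S :\ x) (c - b) y Sc4 yS' cbC.
have : c - b - b' \in bounds_on S p.+1.
  apply: (cone_bounds cb'C xy); rewrite ?inE ?eqxx ?andbF //.
  by rewrite setD1K // setD1K.
move=> /rpredD/(_ (bounds_on_sub (subsetDl _ _) b'B)); rewrite subrK.
by move=> /rpredD/(_ bB); rewrite subrK.
Qed.

End Matching.

(** * Products of triples *)

Section Triples.
Variable n : nat.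
Notation V := 'I_n.
Notation E := (complete_edge n).
Notation Ch := (grass E).
Implicit Types (a b c s : V) (S T : {set V}) (u v w : seq V) (x y z : Ch) (p r : nat).

Lemma link_join_out a b c s y : a != c -> a != s -> link_edge a b y = 0 ->
  link_edge a b (join_edge c s y) = 0.
Proof.
move=> ac as_ y0; rewrite link_edge_join ?y0 ?raddf0 ?oppr0 //.
apply: contraNneq ac => /setP/(_ a); rewrite !inE eqxx (negPf as_) orbF.
by move/esym.
Qed.

Definition join_triple a b c y : Ch := join_edge a b y - join_edge b c y.

Lemma join_triple_is_zmod_morphism a b c : zmod_morphism (join_triple a b c).
Proof. by move=> y z; rewrite /join_triple !raddfB /= addrACA. Qed.
HB.instance Definition _ a b c :=
  GRing.isZmodMorphism.Build Ch Ch (join_triple a b c) (join_triple_is_zmod_morphism a b c).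

Lemma join_triple_rev a b c y : join_triple c b a y = - join_triple a b c y.
Proof. by rewrite /join_triple opprB join_edgeC [join_edge b a y]join_edgeC. Qed.

Lemma join_triple_swap a b c a' b' c' y :
  join_triple a b c (join_triple a' b' c' y) = - join_triple a' b' c' (join_triple a b c y).
Proof.
rewrite /join_triple !raddfB /= !(join_edge_swap a b) !(join_edge_swap b c).
by rewrite addrACA.
Qed.

Lemma join_triple_chains S S' p a b c y : y \in chains_on S p ->
  a \notin S -> b \notin S -> c \notin S -> [set a; b; c] :|: S \subset S' ->
  join_triple a b c y \in chains_on S' p.+1.
Proof.
move=> yS aS bS cS; rewrite !subUset !sub1set => /andP[/andP[/andP[aS' bS'] cS'] SS'].
by rewrite rpredB //; apply: join_chains yS _ _ _;
  rewrite ?aS ?bS ?cS //; rewrite !subUset !sub1set ?aS' ?bS' ?cS'.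
Qed.

Lemma join_triple_cycles S S' p a b c y : y \in cycles_on S p -> a != b -> b != c ->
  a \notin S -> b \notin S -> c \notin S -> [set a; b; c] :|: S \subset S' ->
  join_triple a b c y \in cycles_on S' p.+1.
Proof.
move=> /cycles_onP[yS y0] ab bc aS bS cS SS'; apply/cycles_onP; split.
  exact: join_triple_chains yS _ _ _ SS'.
by rewrite raddfB /= !bound_join // y0 !raddf0 subrr.
Qed.

(** The generator in dimension -1, which serves as the empty product of triples. *)
Definition empty_chain : Ch := [ffun t => (t == set0)%:R].

Lemma empty_chain_cycle S : empty_chain \in cycles_on S 0.
Proof.
apply/cycles_onP; split.
  apply/chains_onP => t; rewrite ffunE; have [-> _|_] := eqVneq t set0; last by rewrite eqxx.
  by rewrite matchings_empty cards0 /covered big_set0 sub0set.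
apply/ffunP => t; rewrite sum_ffunE ffunE big1 // => e _; rewrite !ffunE.
by rewrite setU_eq0 -cards_eq0 cards1 mulr0 if_same.
Qed.

Fixpoint triples (w : seq V) : Ch :=
  if w is a :: b :: c :: w' then join_triple a b c (triples w') else empty_chain.

Lemma triples_cycles r S w : size w = (3 * r)%N -> uniq w -> {subset w <= S} ->
  triples w \in cycles_on S r.
Proof.
elim: r S w => [|r IH] S w.
  by move/size0nil => ->; rewrite empty_chain_cycle.
rewrite mulnS; case: w => [|a [|b [|c w]]] //= [sw]; rewrite !inE !negb_or.
move=> /and4P[/and3P[ab ac aw] /andP[bc bw] cw Uw] wS.
apply: (@join_triple_cycles [set z in w]); rewrite ?inE //.
  by apply: IH => // z; rewrite inE.
by apply/subsetP => z; rewrite !inE => zw; apply: wS; rewrite !inE;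
  case/orP: zw => [/orP[/orP[]|]|] ->; rewrite ?orbT.
Qed.

Lemma join_triple_link a b c y : a != b -> c != b -> link_edge b a y = 0 ->
  c != a ->
  link_edge b a (join_triple a b c y) = y.
Proof.
move=> ab cb y0 ca; rewrite raddfB /= [join_edge a b y]join_edgeC link_edge_join_id 1?eq_sym //.
rewrite y0 raddf0 subr0 link_edgeC link_join_out ?subr0 // 1?eq_sym //.
by rewrite link_edgeC.
Qed.

(** The subgroup generated by products of triples, as an inductive predicate so that additive
    statements can be checked on generators. *)
Inductive triple_span S r : Ch -> Prop :=
| Span0 : triple_span S r 0
| SpanT w of uniq w & size w = (3 * r)%N & {subset w <= S} : triple_span S r (triples w)
| SpanB y z of triple_span S r y & triple_span S r z : triple_span S r (y - z).

Lemma triple_spanD S r y z : triple_span S r y -> triple_span S r z -> triple_span S r (y + z).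
Proof.
move=> Hy Hz; rewrite -[z]opprK -[- z]sub0r; apply: SpanB => //; apply: SpanB => //.
exact: Span0.
Qed.

Lemma triple_span_sum (J : finType) (P : pred J) (F : J -> Ch) S r :
  (forall j, P j -> triple_span S r (F j)) -> triple_span S r (\sum_(j | P j) F j).
Proof. by move=> H; elim/big_rec: _ => [|j y Pj Hy]; [exact: Span0|apply: triple_spanD; auto]. Qed.

Lemma triple_spanMz S r y (m : int) : triple_span S r y -> triple_span S r (y *~ m).
Proof.
have Hn k z : triple_span S r z -> triple_span S r (z *+ k).
  by move=> Hz; elim: k => [|k IH]; [exact: Span0|rewrite mulrS; exact: triple_spanD].
move=> Hy; case: m => k; first exact: Hn.
by rewrite NegzE mulrNz -sub0r; apply: SpanB; [exact: Span0|exact: Hn].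
Qed.

Lemma triple_span_sub S S' r y : S \subset S' -> triple_span S r y -> triple_span S' r y.
Proof.
move=> /subsetP SS'; elim=> [|w Uw sw wS|y' z' _ ? _ ?]; [exact: Span0| |exact: SpanB].
by apply: SpanT => // v /wS/SS'.
Qed.

Lemma triple_span_cycles S r y : triple_span S r y -> y \in cycles_on S r.
Proof.
elim=> [|w Uw sw wS|y' z' _ ? _ ?]; first exact: rpred0.
  exact: triples_cycles.
exact: rpredB.
Qed.

Lemma triples_link_out w a b : a \notin w -> link_edge a b (triples w) = 0.
Proof.
move=> aw; elim: {w}(size w).+1 {-2}w (ltnSn (size w)) aw => // m IH [|c [|d [|e w]]] //= sw;
  try by move=> _; case/cycles_onP: (empty_chain_cycle set0) => H _; exact: link00_chains H.
rewrite !inE !negb_or => /and4P[ac ad ae aw]; rewrite raddfB /= !link_join_out ?subrr //.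
all: by apply: IH => //; lia.
Qed.

(** Prepend the triple [[s b c]]: as [s] is its end, [b s] is the only edge at [s], so one link is
    prescribed and all others at [s] vanish. *)
Lemma triple_span_lift T r s b y : b \in T -> s \in T -> b != s -> #|T| = (3 * r.+1)%N ->
  triple_span (T :\ b :\ s) r y ->
  exists z, [/\ triple_span T r.+1 z, link_edge b s z = y &
    forall b', b' != b -> link_edge b' s z = 0].
Proof.
move=> bT sT bs cT; elim=> [|w Uw sw wT|y1 y2 _ [z1 [S1 E1 H1]] _ [z2 [S2 E2 H2]]].
- by exists 0; split; [exact: Span0|rewrite raddf0|move=> ? ?; rewrite raddf0].
(* [T] without [b] and [s] has 3r+1 vertices, of which [w] uses 3r. *)
- have [c cT' cw] : exists2 c, c \in T :\ b :\ s & c \notin w.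
    apply/subsetPn; apply/negP => /subset_leq_card; apply/negP; rewrite -ltnNge.
    have -> : #|[pred c | c \in w]| = (3 * r)%N by rewrite -sw; exact/card_uniqP.
    move: cT; rewrite (cardsD1 b) bT (cardsD1 s (T :\ b)) !inE eq_sym bs sT.
    by move: #|_| => m; lia.
  have bw : b \notin w by apply/negP => /wT; rewrite !inE eqxx andbF.
  have sw' : s \notin w by apply/negP => /wT; rewrite !inE eqxx.
  move: cT'; rewrite !inE => /and3P[cs cb cT'].
  exists (triples (s :: b :: c :: w)); split=> /=.
  + apply: (@SpanT _ _ (s :: b :: c :: w)) => /=.
    * by rewrite !inE !negb_or eq_sym bs eq_sym cs eq_sym cb sw' bw cw Uw.
    * by rewrite sw mulnS.
    * by move=> z; rewrite !inE => /or4P[/eqP->|/eqP->|/eqP->|/wT] //; rewrite !inE => /and3P[].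
  + by rewrite join_triple_link // 1?eq_sym // triples_link_out.
  + move=> b' b'b; rewrite raddfB /=.
    have Hl : link_edge s b' (triples w) = 0 by rewrite triples_link_out.
    rewrite !(link_edgeC b' s) [X in _ - X]link_join_out // 1?eq_sym // subr0.
    have [->|b's] := eqVneq b' s; first by rewrite (noedgeP _).2.
    by rewrite link_edgeC link_join_out // link_edgeC.
- exists (z1 - z2); split; [exact: SpanB|by rewrite raddfB /= E1 E2|].
  by move=> b' b'b; rewrite raddfB /= H1 // H2 // subrr.
Qed.

(** The two statements feed each other. On 3r+3 vertices, links at [s] live on 3r+1 vertices;
    subtracting lifts of their generators leaves a cycle that can be pushed off [s]. On 3r+4
    vertices, links at [s] bound by connectivity, and pushing off [s] leads to the previous case
    with [s] as the added vertex. In the first statement [z] is chosen before [a], which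
    [good_compare] needs. *)
Lemma triples_generate r :
  (forall T y, #|T| = (3 * r)%N -> y \in cycles_on T r ->
     exists2 z, triple_span T r z & forall a, a \notin T -> y - z \in bounds_on (a |: T) r) /\
  (forall S y, #|S| = (3 * r).+1 -> y \in cycles_on S r ->
     exists2 z, triple_span S r z & y - z \in bounds_on S r).
Proof.
elim: r => [|r [IH2 IH1]].
  have H S y : y \in cycles_on S 0 -> triple_span S 0 y.
    move=> /cycles_onP[/chains_onP yS _]; have -> : y = empty_chain *~ (y set0).
      apply/ffunP => t; have -> : (empty_chain *~ y set0) t = empty_chain t *~ y set0.
        by case: (y set0) => k; rewrite ?NegzE ?mulrNz ?[LHS]ffunE -!pmulrn ffunMnE.
      rewrite ffunE; have [->|t0] := eqVneq t set0; first by rewrite intz.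
      rewrite mul0rz; apply/eqP; apply: contraNT t0 => /yS[_ /cards0_eq -> _].
      by rewrite eqxx.
    by apply: triple_spanMz; exact: (@SpanT _ _ [::]).
  by split=> S y _ /H Hy; exists y => //; rewrite subrr ?rpred0 // => a _; rewrite rpred0.
have G2 T y : #|T| = (3 * r.+1)%N -> y \in cycles_on T r.+1 ->
     exists2 z, triple_span T r.+1 z & forall a, a \notin T -> y - z \in bounds_on (a |: T) r.+1.
  move=> cT yT; have [s sT] : exists s, s \in T by apply/card_gt0P; rewrite cT.
  have /choice[z Hz] b : exists z, b \in T :\ s ->
     [/\ triple_span T r.+1 z, link_edge b s y - link_edge b s z \in bounds_on (T :\ b :\ s) r &
     forall b', b' != b -> link_edge b' s z = 0].
    have [bT|_] := boolP (b \in T :\ s); last by exists 0.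
    move: bT; rewrite !inE => /andP[bs bT].
    have [|z' Sz' Bz'] := IH1 (T :\ b :\ s) (link_edge b s y) _ (link_cycles _ _ yT).
      move: cT; rewrite (cardsD1 b) bT (cardsD1 s (T :\ b)) !inE eq_sym bs sT.
      by move: #|_| => m; lia.
    have [z [Sz Ez Hz]] := triple_span_lift bT sT bs cT Sz'.
    by exists z; rewrite Ez.
  exists (\sum_(b in T :\ s) z b); first by apply: triple_span_sum => b /Hz[].
  move=> a aT; have ZT : \sum_(b in T :\ s) z b \in cycles_on T r.+1.
    by apply: triple_span_cycles; apply: triple_span_sum => b /Hz[].
  have [|b bB Hb] := @push_off _ T r s (y - \sum_(b in T :\ s) z b) sT (rpredB yT ZT).
    move=> b bT; have [_ Bb _] := Hz b bT.
    rewrite raddfB raddf_sum /= (bigD1 b) //= [X in _ - (_ + X)]big1 ?addr0 //.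
    by move=> b' /andP[b'T b'b]; have [_ _ ->] := Hz b' b'T; rewrite 1?eq_sym.
  rewrite -[X in X \in _](subrK b); apply: rpredD; last exact: bounds_on_sub (subsetUr _ _) bB.
  (* The remaining cycle avoids [s] and the added vertex [a], so the edge [s a] cones it off. *)
  apply: (cone_bounds Hb (x := s) (y := a)); rewrite ?inE ?eqxx ?(negPf aT) ?andbF //.
    by apply: contraNneq aT => <-.
  by rewrite setUCA setD1K.
split=> // S y cS yS.
have [s sS] : exists s, s \in S by apply/card_gt0P; rewrite cS.
have [a aS|b bB ybS] := @push_off _ S r s y sS yS.
  apply: connectivity; last exact: link_cycles.
  move: aS; rewrite !inE => /andP[as_ aS]; move: cS.
  rewrite (cardsD1 a) aS (cardsD1 s (S :\ a)) !inE eq_sym as_ sS.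
  by move: #|_| => m; lia.
have [|z Sz Bz] := G2 (S :\ s) (y - b) _ ybS.
  by move: cS; rewrite (cardsD1 s) sS => -[].
exists z; first by apply: triple_span_sub Sz; apply: subsetDl.
have := Bz s; rewrite !inE eqxx setD1K // => /(_ isT) /rpredD/(_ bB).
by rewrite addrAC subrK.
Qed.

End Triples.

(** * Signs of vertex orderings *)

Section Signs.
Variable n : nat.
Notation V := 'I_n.
Implicit Types (a b c : V) (u v w : seq V).

Fixpoint inversions w : nat :=
  if w is a :: w' then (count (fun b => (b < a)%N) w' + inversions w')%N else 0%N.

Definition sgn w : 'Z_3 := (-1) ^+ inversions w.

Definition cross u v : nat := (\sum_(a <- u) count (fun b => (b < a)%N) v)%N.

Lemma sgnK w : sgn w * sgn w = 1.
Proof. by rewrite -expr2 sqrr_sign. Qed.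

Lemma inversions_cat u v : inversions (u ++ v) = (inversions u + inversions v + cross u v)%N.
Proof.
elim: u => [|a u IH] /=; first by rewrite /cross big_nil addn0.
by rewrite IH count_cat /cross big_cons; lia.
Qed.

Lemma cross_perm u u' v v' : perm_eq u u' -> perm_eq v v' -> cross u v = cross u' v'.
Proof.
move=> uu' vv'; rewrite /cross (perm_big _ uu') /=; apply: eq_bigr => a _.
exact/permP.
Qed.

Lemma cross_swap u v : uniq (u ++ v) -> (cross u v + cross v u = size u * size v)%N.
Proof.
rewrite /cross; elim: u => [|a u IH] /=.
  by move=> _; rewrite big_nil mul0n big1.
rewrite mulSn => /andP[auv /IH <-]; rewrite big_cons.
have -> : (\sum_(b <- v) count (fun c => (c < b)%N) (a :: u) =
           count (fun b => (a < b)%N) v + \sum_(b <- v) count (fun c => (c < b)%N) u)%N.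
  rewrite big_split /= -sum1_count; congr (_ + _)%N.
  rewrite [RHS]big_mkcond; by apply: eq_bigr => b _; case: ifP.
have : (count (fun b => (b < a)%N) v + count (fun b => (a < b)%N) v = size v)%N.
  rewrite -(count_predC (fun b => (b < a)%N)); congr (_ + _)%N; apply: eq_in_count => b bv /=.
  rewrite -leqNgt ltn_neqAle andb_idl // => _; apply: contraNneq auv => /ord_inj ->.
  by rewrite mem_cat bv orbT.
by move=> <-; lia.
Qed.

(** Inversions between a block and its surroundings depend only on the block as a set, so the ratio
    of signs is that of the blocks alone; the products avoid a division. *)
Lemma sgn_context u v w w' : perm_eq w w' ->
  sgn (u ++ w ++ v) * sgn w' = sgn (u ++ w' ++ v) * sgn w.
Proof.
move=> ww'; rewrite /sgn -!exprD !inversions_cat.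
rewrite (cross_perm ww' (perm_refl v)) (@cross_perm u u (w ++ v) (w' ++ v)) ?perm_refl //.
  by congr (_ ^+ _); lia.
by rewrite perm_cat2r.
Qed.

Lemma sgn_swap u v w w' : uniq (w ++ w') ->
  sgn (u ++ w' ++ w ++ v) = (-1) ^+ (size w * size w') * sgn (u ++ w ++ w' ++ v).
Proof.
move=> Uw; have P : perm_eq (w' ++ w) (w ++ w') by rewrite perm_catC.
have := sgn_context u v P; rewrite -!catA => /(congr1 (fun x : 'Z_3 => x * sgn (w ++ w'))).
rewrite -!mulrA sgnK mulr1 => ->; rewrite mulrC; congr (_ * _).
rewrite /sgn -exprD !inversions_cat -cross_swap //.
rewrite (_ : (_ + _ = (inversions w + inversions w').*2 + (cross w w' + cross w' w))%N).
  by rewrite exprD -mul2n exprM sqrrN !expr1n mul1r.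
by lia.
Qed.

Lemma sgn_tr u v a b : a != b -> sgn (u ++ a :: b :: v) = - sgn (u ++ b :: a :: v).
Proof.
move=> ab; rewrite (@sgn_swap u v [:: b] [:: a]) /=; last by rewrite inE eq_sym ab.
by rewrite mulN1r.
Qed.

Lemma sgn_rev3 a b c v : uniq [:: a; b; c] ->
  sgn [:: c, b, a & v] = - sgn [:: a, b, c & v].
Proof.
rewrite /= !inE !negb_or => /and3P[/andP[ab ac] bc _].
rewrite (@sgn_tr [::]) 1?eq_sym // (@sgn_tr [:: b]) 1?eq_sym //= opprK.
by rewrite (@sgn_tr [::]) // eq_sym.
Qed.

End Signs.

(** * Properties required of the functional, and moves of the spare vertex *)

Section Functional.
Variable n : nat.
Notation V := 'I_n.
Notation E := (complete_edge n).
Notation Ch := (grass E).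
Implicit Types (a b c s N : V) (S T : {set V}) (u v w : seq V) (x y z : Ch) (p q r : nat).

Definition flip (k : bool) (A : zmodType) (x : A) : A := if k then - x else x.

Arguments flip !k {A} x /.

(** Reversing a triple, or moving one past another (nine transpositions), negates both the product
    and the sign of the ordering, so one [k] serves both. Reversal ensures that [N] is never the
    first entry. *)
Lemma triples_front r w N : size w = (3 * r)%N -> uniq w -> N \in w ->
  exists a b c w' k, [/\ perm_eq w [:: a, b, c & w'],
    triples w = flip k (triples [:: a, b, c & w']),
    forall v, uniq (w ++ v) -> sgn (w ++ v) = flip k (sgn ([:: a, b, c & w'] ++ v))
    & N = b \/ N = c].
Proof.
elim: r w => [|r IH] w; first by move/size0nil->.
rewrite mulnS; case: w => [|a [|b [|c w]]] // [sw] Uw.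
rewrite inE; case/orP => [/eqP ->|].
  exists c, b, a, w, true; split=> /=.
  - by apply/permP => P /=; lia.
  - by rewrite join_triple_rev.
  - move=> v U; rewrite sgn_rev3 //.
    have : uniq [:: a; b; c] by move: (U : uniq ([:: a; b; c] ++ (w ++ v)));
      rewrite cat_uniq => /andP[].
    by rewrite -rev_uniq.
  - by right.
rewrite inE; case/orP => [/eqP ->|].
  by exists a, b, c, w, false; split=> //; left.
rewrite inE; case/orP => [/eqP ->|Nw].
  by exists a, b, c, w, false; split=> //; right.
have Uw' : uniq w by move: (Uw : uniq ([:: a; b; c] ++ w)); rewrite cat_uniq => /and3P[].
have [a' [b' [c' [w' [k [P Ht Hs HN]]]]]] := IH w sw Uw' Nw.
exists a', b', c', [:: a, b, c & w'], (~~ k); split=> //.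
- rewrite -(perm_cat2l [:: a; b; c]) in P; apply: perm_trans P _.
  by apply/permP => Q /=; lia.
- rewrite /= Ht /=; case: {Ht Hs} k => /=; rewrite ?raddfN /=; by rewrite join_triple_swap ?opprK.
- move=> v U; have Uwv : uniq (w ++ v) by move: (U : uniq ([:: a; b; c] ++ (w ++ v)));
  rewrite cat_uniq => /and3P[].
  have Pv : perm_eq (w ++ v) ([:: a', b', c' & w'] ++ v) by rewrite perm_cat2r.
  have U3 : uniq ([:: a; b; c] ++ [:: a'; b'; c']).
    have : uniq ([:: a; b; c] ++ [:: a', b', c' & w'] ++ v).
      by rewrite -(perm_uniq (_ : perm_eq ([:: a; b; c] ++ w ++ v) _)) // perm_cat2l.
    by rewrite catA -[[:: a', b', c' & w']]/([:: a'; b';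
      c'] ++ w') catA !(cat_uniq (_ ++ _)) => /and3P[/and3P[]].
  have swap : sgn ([:: a', b', c', a, b, c & w'] ++ v) =
              - sgn ([:: a; b; c] ++ [:: a', b', c' & w'] ++ v).
    by rewrite (@sgn_swap n [::] (w' ++ v) [:: a; b; c] [:: a'; b'; c']) // -signr_odd mulN1r.
  have := @sgn_context n [:: a; b; c] [::] _ _ Pv; rewrite !cats0 (Hs _ Uwv).
  move/(congr1 (fun x : 'Z_3 => x * sgn ([:: a', b', c' & w'] ++ v))).
  rewrite -mulrA sgnK mulr1 swap => ->.
  by case: k {Ht Hs} => /=; rewrite ?mulrN ?mulNr -mulrA sgnK mulr1 ?opprK.
Qed.

(** Used with 3r+1 vertices in [S], where [rcons w a] lists all of [S] and [a] is the spare vertex.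
    Additivity is asked on cycles only, since elsewhere the value depends on arbitrary choices. *)
Definition good r S (g : Ch -> 'Z_3) : Prop :=
  [/\ forall y z, y \in cycles_on S r -> z \in cycles_on S r -> g (y - z) = g y - g z,
      forall y, y \in bounds_on S r -> g y = 0
    & forall w a, uniq (rcons w a) -> size w = (3 * r)%N -> {subset rcons w a <= S} ->
        g (triples w) = sgn (rcons w a)].

Lemma good0 r S g : good r S g -> g 0 = 0.
Proof. by case=> gB _ _; rewrite -[in LHS](subrr (0 : Ch)) gB ?subrr ?rpred0. Qed.

Lemma goodN r S g y : good r S g -> y \in cycles_on S r -> g (- y) = - g y.
Proof. by move=> gg yS; have [gB _ _] := gg;
  rewrite -[- y]sub0r gB ?rpred0 // (good0 gg) sub0r. Qed.

Lemma goodD r S g y z : good r S g -> y \in cycles_on S r -> z \in cycles_on S r ->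
  g (y + z) = g y + g z.
Proof.
move=> gg yS zS; have [gB _ _] := gg.
by rewrite -[z in g (_ + z)]opprK gB ?rpredN // (goodN gg) // opprK.
Qed.

Lemma good_sum r S g (J : finType) (P : pred J) (F : J -> Ch) : good r S g ->
  (forall j, P j -> F j \in cycles_on S r) -> g (\sum_(j | P j) F j) = \sum_(j | P j) g (F j).
Proof.
move=> gg FS; suff [] : g (\sum_(j | P j) F j) = \sum_(j | P j) g (F j) /\
   \sum_(j | P j) F j \in cycles_on S r by [].
elim/big_rec2: _ => [|j y z Pj [<- yS]]; first by rewrite (good0 gg) rpred0.
by rewrite (goodD gg) ?FS // rpredD ?FS.
Qed.

Lemma good_flip r S g k y : good r S g -> y \in cycles_on S r -> g (flip k y) = flip k (g y).
Proof. by case: k => //= gg yS; rewrite (goodN gg). Qed.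

(** Modulo boundaries, [y] is the same combination of products on [T] whether [a] or [b] is added.
    On products both values are known, and their ratio does not depend on the product by
    [sgn_context]. *)
Lemma good_compare r T a b (ga gb : Ch -> 'Z_3) y u : #|T| = (3 * r)%N ->
  a \notin T -> b \notin T -> good r (a |: T) ga -> good r (b |: T) gb ->
  uniq u -> u =i T -> y \in cycles_on T r ->
  ga y * sgn (rcons u a) = gb y * sgn (rcons u b).
Proof.
move=> cT aT bT Ga Gb Uu uT yT; have [z Sz Hz] := (triples_generate n r).1 T y cT yT.
have ST c : T \subset c |: T by apply: subsetUr.
have red c g : c \notin T -> good r (c |: T) g -> g y = g z.
  move=> cT' gg; have := Hz c cT'; have zT := triple_span_cycles Sz.
  have [gB g0 _] := gg; move=> /g0/eqP.
  by rewrite (gB _ _ (cycles_on_sub (ST c) yT) (cycles_on_sub (ST c) zT)) subr_eq0 => /eqP.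
rewrite (red a ga) // (red b gb) //; elim: Sz => [|w Uw sw wT|y1 y2 S1 IH1 S2 IH2].
- by rewrite (good0 Ga) (good0 Gb) !mul0r.
- have wu : perm_eq w u.
    have wsub : {subset w <= u} by move=> v /wT; rewrite uT.
    have sz : (size u <= size w)%N by rewrite sw -cT -(eq_card uT) (card_uniqP Uu).
    by have [_ wu] := uniq_min_size Uw wsub sz; apply: uniq_perm.
  have key c g : c \notin T -> good r (c |: T) g -> g (triples w) * sgn (rcons u c) = sgn w * sgn u.
    move=> cT' [_ _ gT]; rewrite (gT w c) //; first last.
    - by move=> v; rewrite mem_rcons !inE => /orP[->//|/wT->]; rewrite orbT.
    - by rewrite rcons_uniq Uw andbT; apply: contra cT' => /wT.
    rewrite -!cats1; have := @sgn_context n [::] [:: c] _ _ wu.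
    move/(congr1 (fun x : 'Z_3 => x * sgn u)); rewrite /= -mulrA sgnK mulr1 => ->.
    by rewrite mulrC !mulrA sgnK mul1r.
  by rewrite (key a ga) // (key b gb).
- have C1 := triple_span_cycles S1; have C2 := triple_span_cycles S2.
  have [gaB _ _] := Ga; have [gbB _ _] := Gb.
  have Ca c := cycles_on_sub (ST c) C1; have Cb c := cycles_on_sub (ST c) C2.
  by rewrite (gaB _ _ (Ca a) (Cb a)) (gbB _ _ (Ca b) (Cb b)) !mulrBl IH1 IH2.
Qed.

(** The boundary of the part of [y] avoiding [s] must cancel the boundary of the part covering [s],
    which is the sum of the links. *)
Lemma links_bound S p y s : s \in S -> y \in cycles_on S p.+1 ->
  \sum_(b in S :\ s) link_edge b s y \in bounds_on (S :\ s) p.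
Proof.
move=> sS yC; have [yS y0] := cycles_onP _ _ _ yC.
apply/bounds_onP; exists (- (y - \sum_(b in S :\ s) join_edge b s (link_edge b s y))).
  by rewrite rpredN chains_on_split.
rewrite raddfN raddfB /= y0 sub0r opprK raddf_sum /=; apply: eq_bigr => b bS.
rewrite bound_join; last by move: bS; rewrite !inE => /andP[].
by rewrite bound_link y0 raddf0 oppr0 raddf0 subr0.
Qed.

(** The two disjoint edges form a 1-simplex, whose join with the cycle [y] is the filling. *)
Lemma opposite_edges S T p a b c s y : y \in cycles_on T p -> uniq [:: a; b; c; s] ->
  [disjoint [:: a; b; c; s] & T] -> {subset [:: a; b; c; s] <= S} -> T \subset S ->
  join_edge a s y - join_edge b c y \in bounds_on S p.+1.
Proof.
move=> /cycles_onP[yT y0] U D SS TS; apply/bounds_onP; exists (join_edge b c (join_edge a s y)).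
  have out (d : V) : d \in [:: a; b; c; s] -> d \notin T by move=> dd; rewrite (disjointFr D dd).
  move: U; rewrite /= !inE !negb_or => /and4P[/and3P[ab ac as_] /andP[bc bs] cs _].
  apply: (@join_chains _ (a |: (s |: T))).
  - by apply: join_chains yT _ _ _ => //; apply: out; rewrite !inE eqxx ?orbT.
  - by rewrite !inE !negb_or eq_sym ab bs out // !inE eqxx ?orbT.
  - by rewrite !inE !negb_or eq_sym ac cs out // !inE eqxx ?orbT.
  - by rewrite !subUset !sub1set TS !SS // !inE eqxx ?orbT.
move: U; rewrite /= !inE !negb_or => /and4P[/and3P[ab ac as_] /andP[bc bs] cs _].
by rewrite bound_join // bound_join // y0 raddf0 subr0.
Qed.

(** The edge [a b] cancels and the difference of the opposite edges [a s] and [b c] is left. The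
    spare vertex passes from [s] to [c] by a 4-cycle, an odd permutation. *)
Lemma spare_end S T p a b c s y : y \in cycles_on T p -> uniq [:: a; b; c; s] ->
  [disjoint [:: a; b; c; s] & T] -> {subset [:: a; b; c; s] <= S} -> T \subset S ->
  join_triple a b c y + join_triple s a b y \in bounds_on S p.+1.
Proof.
move=> yT U D SS TS; rewrite /join_triple addrC (join_edgeC s a) addrA subrK.
exact: opposite_edges yT U D SS TS.
Qed.

Lemma spare_middle S T p a b c s y : y \in cycles_on T p -> uniq [:: a; b; c; s] ->
  [disjoint [:: a; b; c; s] & T] -> {subset [:: a; b; c; s] <= S} -> T \subset S ->
  join_triple a b c y + join_triple a s c y \in bounds_on S p.+1.
Proof.
move=> yT U D SS TS; rewrite /join_triple (join_edgeC s c) [X in _ + X]addrC addrACA.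
rewrite [X in _ + X]addrC; apply: rpredD; last exact: opposite_edges yT U D SS TS.
have P : perm_eq [:: a; c; s; b] [:: a; b; c; s] by apply/permP => Q /=; lia.
apply: opposite_edges yT _ _ _ TS; rewrite ?(perm_uniq P) ?(eq_disjoint (perm_mem P)) //.
by move=> d; rewrite (perm_mem P); apply: SS.
Qed.

End Functional.

(** * The functional modulo 3 *)

Lemma uniq3 (T : eqType) (x y z : T) w : uniq [:: x, y, z & w] ->
  [/\ x != y, x != z & y != z] /\ [/\ x \notin w, y \notin w, z \notin w & uniq w].
Proof. by rewrite /= !inE !negb_or => /and4P[/and3P[-> -> ->] /andP[-> ->] -> ->]. Qed.

Lemma Z3_opp_double (x : 'Z_3) : - (x + x) = x.
Proof. by apply/val_inj; case: x => [[|[|[|]]]]. Qed.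

Lemma sgn_exchange n (a b : 'I_n) t u v : uniq [:: a, b & u] ->
  sgn (t ++ a :: u ++ b :: v) = - sgn (t ++ b :: u ++ a :: v).
Proof.
move=> U; have Ub : uniq ([:: b] ++ (a :: u)).
  by move: U; rewrite /= !inE !negb_or eq_sym => /and3P[/andP[-> ->] -> ->].
rewrite (@sgn_swap n t v [:: b] (a :: u) Ub).
have Ua : uniq (u ++ [:: a]) by rewrite uniq_catC /=; move: U => /= /and3P[];
  rewrite inE negb_or => /andP[_ ->].
have := @sgn_swap n (t ++ [:: b]) v u [:: a] Ua; rewrite -!catA /= => ->.
by rewrite mulrA -exprD mul1n muln1 addSn addnn -signr_odd /= odd_double mulN1r.
Qed.

Section Step.
Variables (n r : nat).
Notation V := 'I_n.
Notation E := (complete_edge n).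
Notation Ch := (grass E).
Variable gg : {set V} -> Ch -> 'Z_3.
Hypothesis ggP : forall T : {set V}, #|T| = (3 * r).+1 -> good r T (gg T).
Variables (S : {set V}) (s N : V).
Hypotheses (cS : #|S| = (3 * r.+1).+1) (sS : s \in S) (NS : N \in S) (Ns : N != s).
Implicit Types (a b c : V) (w : seq V) (y z : Ch).

Let S0 := S :\ s.

(** The sign of inserting [b, N] before and [s] after an ordering of the other vertices; the chosen
    enumeration is immaterial by [link_signE]. *)
Definition link_sign (b : V) : 'Z_3 :=
  sgn [:: b, N & rcons (enum (S0 :\ b :\ N)) s] * sgn (enum (S0 :\ b :\ N)).

(* For cycles avoiding [s]; the sum runs over the links at the vertex [N]. *)
Definition link_functional (y : Ch) : 'Z_3 :=
  (-1) ^+ r.+1 * \sum_(b in S0 :\ N) link_sign b * gg (S0 :\ b :\ N) (link_edge b N y).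

Lemma link_signE b w : uniq w -> w =i S0 :\ b :\ N ->
  sgn [:: b, N & rcons w s] = link_sign b * sgn w.
Proof.
move=> Uw wE; rewrite /link_sign; set u := enum _.
have P : perm_eq w u by apply: uniq_perm; rewrite ?enum_uniq // => v; rewrite wE mem_enum.
have := sgn_context [:: b; N] [:: s] P; rewrite /= !cats1 => /(congr1 (fun x : 'Z_3 => x * sgn u)).
by rewrite -mulrA sgnK mulr1 => ->; rewrite -!mulrA [sgn w * _]mulrC.
Qed.

Lemma card_link b : b \in S0 :\ N -> #|S0 :\ b :\ N| = (3 * r).+1.
Proof.
rewrite !inE => /and3P[bN bs bS]; move: cS.
rewrite (cardsD1 s) sS (cardsD1 b (S :\ s)) !inE bs bS (cardsD1 N (_ :\ b)) !inE eq_sym bN Ns NS.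
by rewrite -/S0; move: #|_| => m; lia.
Qed.

Lemma link_functionalB y z : y \in cycles_on S0 r.+1 -> z \in cycles_on S0 r.+1 ->
  link_functional (y - z) = link_functional y - link_functional z.
Proof.
move=> yS zS; rewrite /link_functional -mulrBr -sumrB; congr (_ * _).
apply: eq_bigr => b bS; have [gB _ _] := ggP (card_link bS).
by rewrite raddfB /= (gB _ _ (link_cycles _ _ yS) (link_cycles _ _ zS)) mulrBr.
Qed.

Lemma link_functional0 : link_functional 0 = 0.
Proof. by rewrite -[in LHS](subrr 0) link_functionalB ?subrr // rpred0. Qed.

Lemma link_functionalN y : y \in cycles_on S0 r.+1 -> link_functional (- y) = - link_functional y.
Proof. by move=> yS; rewrite -[- y]sub0r link_functionalB ?rpred0 // link_functional0 sub0r. Qed.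

Lemma link_functionalD y z : y \in cycles_on S0 r.+1 -> z \in cycles_on S0 r.+1 ->
  link_functional (y + z) = link_functional y + link_functional z.
Proof.
move=> yS zS.
by rewrite -[z in link_functional (_ + z)]opprK link_functionalB ?rpredN // link_functionalN //
  opprK.
Qed.

Lemma link_third a b d w : uniq [:: a; b; N] -> N \notin w ->
  link_edge d N (triples [:: a, b, N & w]) = if d == b then - triples w else 0.
Proof.
rewrite /= !inE !negb_or => /and3P[/andP[ab aN] bN _] Nw.
have Nd x : link_edge N x (triples w) = 0 by rewrite triples_link_out.
rewrite raddfB /= link_edgeC link_join_out // ?sub0r 1?eq_sym //.
have [->|db] := eqVneq d b; last first.
  have [->|dN] := eqVneq d N; first by rewrite (noedgeP _).2 oppr0.
  by rewrite link_join_out ?oppr0 // link_edgeC.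
by rewrite link_edge_join_id // link_edgeC Nd raddf0 subr0.
Qed.

Lemma link_middle a c d w : uniq [:: a; N; c] -> N \notin w ->
  link_edge d N (triples [:: a, N, c & w]) =
    if d == a then triples w else if d == c then - triples w else 0.
Proof.
rewrite /= !inE !negb_or => /and3P[/andP[aN ac] Nc _] Nw.
have Nd x : link_edge N x (triples w) = 0 by rewrite triples_link_out.
have [->|dN] := eqVneq d N.
  by rewrite (noedgeP _).2 eq_sym (negPf aN) (negPf Nc).
rewrite raddfB /= [join_edge N c _]join_edgeC.
have [->|da] := eqVneq d a.
  rewrite link_edge_join_id // link_edgeC Nd raddf0 subr0 link_join_out ?subr0 //.
  by rewrite link_edgeC.
rewrite link_join_out // ?sub0r; last by rewrite link_edgeC.
have [->|dc] := eqVneq d c; last by rewrite link_join_out ?oppr0 // link_edgeC.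
by rewrite link_edge_join_id 1?eq_sym // link_edgeC Nd raddf0 subr0.
Qed.

(** After [triples_front], [N] is last or in the middle of the first triple. If last, a single link
    contributes, and the factor [(-1) ^+ r.+1] normalises it to the sign. If in the middle, two
    links contribute minus the sign each, and -2 = 1 modulo 3. *)
Lemma link_functional_triples w : uniq w -> size w = (3 * r.+1)%N -> w =i S0 ->
  link_functional (triples w) = sgn (rcons w s).
Proof.
move=> Uw sw wS0; have Nw : N \in w by rewrite wS0 !inE Ns.
have sw' : s \notin w by rewrite wS0 !inE eqxx.
have [a [b [c [w' [k [P Et Es HN]]]]]] := triples_front sw Uw Nw.
have U : uniq [:: a, b, c & w'] by rewrite -(perm_uniq P).
have sw1 : size w' = (3 * r)%N by have := perm_size P; rewrite sw mulnS /= => -[].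
have memE v : v \in [:: a, b, c & w'] = (v \in S0) by rewrite -(perm_mem P) wS0.
have tC : triples [:: a, b, c & w'] \in cycles_on S0 r.+1.
  by apply: triples_cycles => //; rewrite /= ?sw1 ?mulnS // => v; rewrite memE.
rewrite Et -[rcons w s]cats1 Es ?cats_uniq ?cats1 ?rcons_uniq ?sw' //.
suff H : link_functional (triples [:: a, b, c & w']) = sgn [:: a, b, c & rcons w' s].
  by case: k {Et Es} => /=; rewrite ?link_functionalN // H.
have [[ab ac bc] [aw bw cw Uw']] := uniq3 U.
have sw1' : s \notin w' by apply: contra sw' => sw1'; rewrite (perm_mem P) !inE sw1' !orbT.
have valS (x d : V) : perm_eq [:: x; N; d] [:: a; b; c] ->
    x \in S0 :\ N /\ {subset w' <= S0 :\ x :\ N}.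
  move=> P3; have P4 : perm_eq [:: x, N, d & w'] [:: a, b, c & w'].
    by rewrite (perm_cat2r w' [:: x; N; d] [:: a; b; c]).
  have U4 : uniq [:: x, N, d & w'] by rewrite (perm_uniq P4).
  have [[xN xd Nd] [xw Nw' dw _]] := uniq3 U4.
  split; first by rewrite in_setD1 xN -memE -(perm_mem P4) inE eqxx.
  move=> v vw; rewrite 2!in_setD1 -memE -(perm_mem P4) !inE vw !orbT andbT.
  by rewrite (memPn Nw') // (memPn xw).
have val (x d : V) : perm_eq [:: x; N; d] [:: a; b; c] ->
    gg (S0 :\ x :\ N) (triples w') = sgn (rcons w' d) /\
    link_sign x * sgn (rcons w' d) = (-1) ^+ r * sgn [:: d, x, N & rcons w' s].
  move=> P3; have P4 : perm_eq [:: x, N, d & w'] [:: a, b, c & w'].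
    by rewrite (perm_cat2r w' [:: x; N; d] [:: a; b; c]).
  have U4 : uniq [:: x, N, d & w'] by rewrite (perm_uniq P4).
  have mem4 v : (v \in rcons w' d) = (v \in S0 :\ x :\ N).
    rewrite mem_rcons 2![in RHS]in_setD1 -memE -(perm_mem P4) !inE.
    have [[xN xd Nd] [xw Nw' dw _]] := uniq3 U4.
    have [->|vx] := eqVneq v x; first by rewrite (negPf xd) (negPf xw) andbF.
    have [->|vN] := eqVneq v N; first by rewrite (negPf Nd) (negPf Nw').
    by [].
  have Uy : uniq (rcons w' d).
    by rewrite rcons_uniq; move: U4 => /= /and4P[_ _ -> ->].
  have xS : x \in S0 :\ N.
    by rewrite in_setD1 -memE -(perm_mem P4) inE eqxx andbT; have [[]] := uniq3 U4.
  split; first by have [_ _ gT] := ggP (card_link xS); apply: gT => // v; rewrite mem4.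
  rewrite -link_signE // -!cats1 -!catA.
  have U5 : uniq ([:: d] ++ [:: x, N & w']).
    rewrite -(perm_uniq (s1 := [:: x, N, d & w'])) //.
    by rewrite (perm_catCA [:: x; N] [:: d] w').
  (* Moving [d] past [x], [N] and the 3r entries of [w'] costs [(-1) ^+ (3r+2)], which is
     [(-1) ^+ r]. *)
  rewrite (@sgn_swap n [::] [:: s] [:: d] [:: x, N & w'] U5) /=.
  rewrite sw1 mul1n; congr (_ * _).
  by rewrite -[LHS]signr_odd -[RHS]signr_odd /= oddM negbK.
have valN (x d : V) : perm_eq [:: x; N; d] [:: a; b; c] ->
    link_sign x * gg (S0 :\ x :\ N) (- triples w') = - ((-1) ^+ r * sgn [:: d, x, N & rcons w' s]).
  move=> P3; have [E1 E2] := val x d P3.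
  have [xS wS] := valS x d P3.
  by rewrite (goodN (ggP (card_link xS))) ?mulrN ?E1 ?E2 //; apply: triples_cycles.
case: HN => HN; [subst b|subst c].
  have P1 : perm_eq [:: c; N; a] [:: a; N; c] by rewrite perm_sym -perm_rev.
  have U3 : uniq [:: a; N; c] by rewrite /= !inE !negb_or ab ac bc.
  have [aS _] := valS a c (perm_refl _); have [cS' _] := valS c a P1.
  rewrite /link_functional (bigD1 a) //= (bigD1 c) /=; last by rewrite cS' eq_sym.
  rewrite big1 ?addr0 => [|d /andP[/andP[dS da] dc]]; last first.
    by rewrite link_middle // (negPf da) (negPf dc) (good0 (ggP (card_link dS))) mulr0.
  rewrite !link_middle // eqxx [c == a]eq_sym (negPf ac) eqxx.
  have [-> E2] := val a c (perm_refl _); rewrite E2 (valN c a P1) // -mulrBr mulrA -exprD.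
  rewrite -signr_odd oddD /= addNb addbb mulN1r.
  have e1 : sgn [:: a, c, N & rcons w' s] = - sgn [:: a, N, c & rcons w' s].
    by rewrite (@sgn_tr n [:: a]) // eq_sym.
  by rewrite (@sgn_tr n [::]) 1?eq_sym //= e1 opprK Z3_opp_double.
have P3 : perm_eq [:: b; N; a] [:: a; b; N] by rewrite (perm_catC [:: b; N] [:: a]).
have U3 : uniq [:: a; b; N] by rewrite /= !inE !negb_or ab ac bc.
have [bS _] := valS b a P3.
rewrite /link_functional (bigD1 b) //= big1 ?addr0 => [|d /andP[dS db]].
  rewrite link_third // eqxx (valN b a P3).
  by rewrite mulrN mulrA -exprD -signr_odd oddD /= addNb addbb mulN1r opprK.
by rewrite link_third // (negPf db) (good0 (ggP (card_link dS))) mulr0.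
Qed.

Lemma link_functional_sum (J : finType) (P : pred J) (F : J -> Ch) :
  (forall j, P j -> F j \in cycles_on S0 r.+1) ->
  link_functional (\sum_(j | P j) F j) = \sum_(j | P j) link_functional (F j).
Proof.
move=> FS; suff [] : link_functional (\sum_(j | P j) F j) = \sum_(j | P j) link_functional (F j)
   /\ \sum_(j | P j) F j \in cycles_on S0 r.+1 by [].
elim/big_rec2: _ => [|j y z Pj [<- yS]]; first by rewrite link_functional0 rpred0.
by rewrite link_functionalD ?FS // rpredD ?FS.
Qed.

(* Moving the spare vertex from [a] to [b] on a cycle avoiding both exchanges
   their roles in the orientation of the whole vertex set. *)
Lemma link_sign_exchange a b y : a \in S0 :\ N -> b \in S0 :\ N -> a != b ->
  y \in cycles_on (S0 :\ a :\ b :\ N) r ->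
  link_sign b * gg (S0 :\ b :\ N) y = - (link_sign a * gg (S0 :\ a :\ N) y).
Proof.
move=> aS bS ab; set T := S0 :\ a :\ b :\ N => yT.
have [aN aS0] := setD1P aS; have [bN bS0] := setD1P bS.
have aT : a \notin T by rewrite !in_setD1 eqxx !andbF.
have bT : b \notin T by rewrite !in_setD1 eqxx andbF.
have Ta : a |: T = S0 :\ b :\ N.
  apply/setP => d; rewrite in_setU1 !in_setD1; have [->|//] := eqVneq d a.
  by rewrite aN ab; have [-> ->] := setD1P aS0.
have Tb : b |: T = S0 :\ a :\ N.
  apply/setP => d; rewrite in_setU1 !in_setD1; have [->|//] := eqVneq d b.
  by rewrite bN eq_sym ab; have [-> ->] := setD1P bS0.
have cT : #|T| = (3 * r)%N by have := card_link bS; rewrite -Ta cardsU1 aT => -[].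
pose u := enum T; have Uu : uniq u by apply: enum_uniq.
have uE : u =i T by move=> d; rewrite mem_enum.
have Ga := ggP (card_link bS); rewrite -Ta in Ga.
have Gb := ggP (card_link aS); rewrite -Tb in Gb.
have Ea : link_sign b * sgn (rcons u a) = sgn [:: b, N & rcons (rcons u a) s].
  rewrite link_signE ?rcons_uniq ?uE ?aT // => d.
  by rewrite mem_rcons -Ta in_setU1 inE uE.
have Eb : link_sign a * sgn (rcons u b) = sgn [:: a, N & rcons (rcons u b) s].
  rewrite link_signE ?rcons_uniq ?uE ?bT // => d.
  by rewrite mem_rcons -Tb in_setU1 inE uE.
have := good_compare cT aT bT Ga Gb Uu uE yT; rewrite Ta Tb => cmp.
have sw : sgn [:: b, N & rcons (rcons u a) s] = - sgn [:: a, N & rcons (rcons u b) s].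
  rewrite -!cats1 -!catA (@sgn_exchange n b a [::] (N :: u)) //=.
  have NT : N \notin T by rewrite in_setD1 eqxx.
  by rewrite /= !in_cons ![_ \in u]uE (negPf aT) (negPf bT) (negPf NT) eq_sym (negPf ab) (negPf
    aN) (negPf bN).
have -> : link_sign b = - (link_sign a * sgn (rcons u b)) * sgn (rcons u a).
  by rewrite Eb -sw -Ea -mulrA sgnK mulr1.
rewrite !mulNr; move: (link_sign a) => e; rewrite -!mulrA; congr (- (_ * _)).
by rewrite [sgn (rcons u a) * _]mulrC cmp mulrCA sgnK mulr1.
Qed.

(** A filling [B] may use [s]. Splitting it there writes [y] as a boundary inside [S0] plus the
    links [l a] of the edges [a s]. Links of the boundary are boundaries; each [l a], which avoids
    [a], is shown to have value 0. *)
Lemma link_functional_bounds y : y \in cycles_on S0 r.+1 -> y \in bounds_on S r.+1 ->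
  link_functional y = 0.
Proof.
move=> yC /bounds_onP[B BS By].
pose l a := link_edge a s B.
have lC a : l a \in cycles_on (S0 :\ a) r.+1.
  apply/cycles_onP; split.
    by have := link_chains a s BS; rewrite /S0 setD1C.
  have [yS _] := cycles_onP _ _ _ yC.
  by rewrite bound_link By link_edgeC (link0_chains _ yS) ?oppr0 // !inE eqxx.
have lC0 a : l a \in cycles_on S0 r.+1 by apply: cycles_on_sub (lC a); apply: subsetDl.
have B0S := chains_on_split s BS; set B0 := B - _ in B0S.
have B0C : bound B0 \in cycles_on S0 r.+1 by apply: bounds_cycles; apply/bounds_onP; exists B0.
have -> : y = bound B0 + \sum_(a in S0) l a.
  suff bE : bound (\sum_(a in S0) join_edge a s (l a)) = \sum_(a in S0) l a.
    by rewrite /B0 raddfB /= By bE subrK.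
  rewrite raddf_sum; apply: eq_bigr => a aS /=; have [_ la0] := cycles_onP _ _ _ (lC a).
  have [as_ _] := setD1P aS; by rewrite (bound_join _ as_) la0 raddf0 subr0.
have LC : \sum_(a in S0) l a \in cycles_on S0 r.+1 by apply: rpred_sum => a _; apply: lC0.
rewrite (link_functionalD B0C LC) (link_functional_sum (fun a _ => lC0 a)).
rewrite -[RHS]addr0; congr (_ + _).
  rewrite /link_functional big1 ?mulr0 // => b bS.
  have [_ g0 _] := ggP (card_link bS); rewrite g0 ?mulr0 //; apply/bounds_onP.
  exists (- link_edge b N B0); last by rewrite raddfN /= bound_link opprK.
  by rewrite rpredN link_chains.
rewrite big1 // => a aS; rewrite /link_functional.
have [laS _] := cycles_onP _ _ _ (lC a).
have [->|aN] := eqVneq a N.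
  rewrite big1 ?mulr0 // => b bS.
  have [NS0 _] := cycles_onP _ _ _ (lC N).
  by rewrite link_edgeC (link0_chains _ NS0) ?setD11 // (good0 (ggP (card_link bS))) mulr0.
have aS' : a \in S0 :\ N by rewrite in_setD1 aN.
rewrite (bigD1 a) //= (link0_chains _ laS) ?setD11 // (good0 (ggP (card_link aS'))) mulr0 add0r.
rewrite (eq_bigl (mem (S0 :\ a :\ N))); last first.
  by move=> b; rewrite /= !in_setD1 andbC andbCA.
have lb b : b \in S0 :\ a :\ N ->
    link_edge b N (l a) \in cycles_on (S0 :\ a :\ b :\ N) r by move=> _; apply: link_cycles.
(* All terms are transferred to the one functional on [S0 :\ a :\ N]; it then sees the sum of all
   links of [l a] at [N], a boundary by [links_bound]. *)
rewrite (eq_bigr (fun b => - link_sign a * gg (S0 :\ a :\ N) (link_edge b N (l a)))); last first.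
  move=> b bS; have [bN /setD1P[ba bS0]] := setD1P bS.
  rewrite mulNr (@link_sign_exchange a b) ?lb //; last by rewrite eq_sym.
  exact/setD1P.
have [_ g0 _] := ggP (card_link aS').
rewrite -mulr_sumr -(good_sum (ggP (card_link aS'))) => [|b bS].
  by rewrite g0 ?mulr0 //; apply: links_bound; rewrite ?in_setD1 1?eq_sym ?aN ?Ns.
apply: cycles_on_sub (lb b bS); apply/subsetP => d /setD1P[dN /setD1P[_ dS]].
exact/setD1P.
Qed.

End Step.

Lemma flip_flip j k (A : zmodType) (x : A) : flip j (flip k x) = flip (j (+) k) x.
Proof. by case: j k => [] [] //=; rewrite opprK. Qed.

Lemma flipB k (A : zmodType) (x y : A) : flip k (x - y) = flip k x - flip k y.
Proof. by case: k => //=; rewrite opprD. Qed.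

Lemma rpred_flip k (A : zmodType) (P : zmodClosed A) (x : A) : x \in P -> flip k x \in P.
Proof. by case: k => //= Px; rewrite rpredN. Qed.

Lemma perm_exchange (T : eqType) (a b : T) t u v :
  perm_eq (t ++ a :: u ++ b :: v) (t ++ b :: u ++ a :: v).
Proof. by apply/permP => Q; rewrite !count_cat /= !count_cat /=; lia. Qed.

(** * Existence of the functional *)

Section Existence.
Variable n : nat.
Notation V := 'I_n.
Notation E := (complete_edge n).
Notation Ch := (grass E).
Implicit Types (a b c s N : V) (S T : {set V}) (u w : seq V) (y z : Ch) (r : nat).

(** A single vertex supports no edge, hence no boundary: the coefficient of the empty matching
    works. *)
Lemma good_exists0 S : #|S| = 1%N -> exists g : Ch -> 'Z_3, good 0 S g.
Proof.
move=> cS; exists (fun y => (y set0)%:~R); split=> [y z _ _|y|w a _].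
- by rewrite !ffunE rmorphB.
- move=> /bounds_onP[b /chains_onP bS <-]; suff -> : b = 0 by rewrite raddf0 ffunE.
  apply/ffunP => t; rewrite ffunE; apply/eqP/negPn/negP => /bS[_ t1 tS].
  have [e et] : exists e, e \in t by apply/card_gt0P; rewrite t1.
  have /subset_leq_card : val e \subset S by apply: subset_trans tS; apply: bigcup_sup.
  by rewrite cS; have [x [y' [xy ->]]] := edge_ends e; rewrite cards2 xy.
- by move=> /size0nil -> _; rewrite ffunE eqxx /sgn.
Qed.

Lemma triples_off_vertex r S s w a : #|S| = (3 * r.+1).+1 -> uniq (rcons w a) ->
  size w = (3 * r.+1)%N -> {subset rcons w a <= S} -> s \in S ->
  exists w' k, [/\ uniq w', size w' = (3 * r.+1)%N, w' =i S :\ s,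
    triples w - flip k (triples w') \in bounds_on S r.+1 &
    sgn (rcons w a) = flip k (sgn (rcons w' s))].
Proof.
move=> cS Uwa sw wS sS.
have wSE : rcons w a =i S.
  have sz : (size (enum S) <= size (rcons w a))%N by rewrite -cardE cS size_rcons sw.
  have [] := uniq_min_size Uwa _ sz; first by move=> v /wS; rewrite mem_enum.
  by move=> _ H v; rewrite H mem_enum.
have /andP[aw Uw] : (a \notin w) && uniq w by rewrite -rcons_uniq.
have [sa|sa] := eqVneq s a.
  exists w, false; split; rewrite ?sa //= ?subrr ?rpred0 //.
  move=> v; rewrite in_setD1 -wSE mem_rcons inE.
  by have [->|] := eqVneq v a; rewrite ?(negPf aw).
have sinw : s \in w by have := wSE s; rewrite sS mem_rcons inE (negPf sa).
have [p [q [c [w' [k [P Et Es Hs]]]]]] := triples_front sw Uw sinw.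
have sw1 : size w' = (3 * r)%N by have := perm_size P; rewrite sw mulnS /= => -[].
have U : uniq [:: p, q, c & w'] by rewrite -(perm_uniq P).
have aP : a \notin [:: p, q, c & w'] by rewrite -(perm_mem P).
have [[pq pc qc] [pw qw cw Uw']] := uniq3 U.
have [ap aq ac aw'] : [/\ a != p, a != q, a != c & a \notin w'].
  by move: aP; rewrite !inE !negb_or => /and4P.
have memS v : (v \in S) = (v == a) || (v \in [:: p, q, c & w']).
  by rewrite -wSE mem_rcons inE (perm_mem P).
pose T := [set v in w'].
have w'C : triples w' \in cycles_on T r by apply: triples_cycles => // v; rewrite inE.
have U4 : uniq [:: p; q; c; a] by rewrite /= !inE !negb_or pq pc qc ![_ == a]eq_sym ap aq ac.
have D4 : [disjoint [:: p; q; c; a] & T].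
  by rewrite disjoint_has /= !inE (negPf pw) (negPf qw) (negPf cw) (negPf aw').
have S4 : {subset [:: p; q; c; a] <= S}.
  by move=> v; rewrite memS !inE => /or4P[]->; rewrite ?orbT.
have TS : T \subset S by apply/subsetP => v; rewrite memS !inE => ->; rewrite !orbT.
have Esgn : sgn (rcons w a) = flip k (sgn [:: p, q, c & rcons w' a]).
  by rewrite -cats1 Es ?cats1 // rcons_uniq.
have build w2 k2 : perm_eq (rcons [:: p, q, c & w'] a) (rcons w2 s) ->
    triples [:: p, q, c & w'] - flip k2 (triples w2) \in bounds_on S r.+1 ->
    sgn [:: p, q, c & rcons w' a] = flip k2 (sgn (rcons w2 s)) ->
    exists w' k, [/\ uniq w', size w' = (3 * r.+1)%N, w' =i S :\ s,
      triples w - flip k (triples w') \in bounds_on S r.+1 &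
      sgn (rcons w a) = flip k (sgn (rcons w' s))].
  move=> P2 H2 s2; exists w2, (k (+) k2).
  have U2 : uniq (rcons w2 s) by rewrite -(perm_uniq P2) rcons_uniq aP.
  move: (U2); rewrite rcons_uniq => /andP[sw2 Uw2]; split=> //.
  - by have := perm_size P2; rewrite !size_rcons /= sw1 mulnS => -[].
  - move=> v; rewrite in_setD1 memS -in_cons -mem_rcons (perm_mem P2) mem_rcons inE.
    by have [->|] := eqVneq v s; rewrite ?(negPf sw2).
  - by rewrite Et -flip_flip -flipB rpred_flip.
  - by rewrite Esgn s2 flip_flip.
case: Hs => Hs.
  apply: (build [:: p, a, c & w'] true).
  - by rewrite -!cats1 Hs (perm_exchange q a [:: p] (c :: w') [::]).
  - by rewrite /= opprK; apply: spare_middle w'C _ _ S4 TS.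
  - rewrite /= -!cats1 Hs (@sgn_exchange n q a [:: p] (c :: w')) //.
    by rewrite /= !inE !negb_or qc qw [q == a]eq_sym aq ac aw' cw.
apply: (build [:: a, p, q & w'] true).
- rewrite -!cats1 Hs; apply: perm_trans (perm_exchange c a [:: p; q] w' [::]) _.
  by rewrite (perm_catCA [:: p; q] [:: a]).
- by rewrite /= opprK; apply: spare_end w'C _ _ S4 TS.
- rewrite /= -!cats1 Hs (@sgn_exchange n c a [:: p; q] w') //; last first.
    by rewrite /= !inE !negb_or cw [c == a]eq_sym ac aw'.
  have U3 : uniq ([:: a] ++ [:: p; q]) by rewrite /= !inE negb_or ap aq pq.
  by rewrite (@sgn_swap n [::] (w' ++ [:: c]) [:: a] [:: p; q] U3) /= mul1n sqrrN expr1n mul1r.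
Qed.

Lemma good_exists r S : #|S| = (3 * r).+1 -> exists g : Ch -> 'Z_3, good r S g.
Proof.
elim: r S => [|r IH] S cS; first exact: good_exists0.
have /choice[gg ggP] T : exists g : Ch -> 'Z_3, #|T| = (3 * r).+1 -> good r T g.
  have [/IH[g Hg]|/eqP cT] := eqVneq #|T| (3 * r).+1; first by exists g.
  by exists (fun=> 0).
have /card_gt1P[s [N [sS NS sN]]] : (1 < #|S|)%N by rewrite cS.
have Ns : N != s by rewrite eq_sym.
pose g := link_functional r gg S s N.
(* [f y] is a cycle homologous to [y] that avoids [s]; by [link_functional_bounds] the choice does
   not affect [g (f y)]. *)
have /choice[f fP] y : exists z, y \in cycles_on S r.+1 ->
    z \in cycles_on (S :\ s) r.+1 /\ y - z \in bounds_on S r.+1.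
  have [yS|_] := boolP (y \in cycles_on S r.+1); last by exists 0.
  have [a aS|b bB ybS] := @push_off _ S r s y sS yS.
    apply: connectivity; last exact: link_cycles.
    have [as_ aS'] := setD1P aS; move: cS.
    rewrite (cardsD1 a) aS' (cardsD1 s (S :\ a)) in_setD1 eq_sym as_ sS.
    by move: #|_| => m; lia.
  by exists (y - b); rewrite subKr.
have S0S : S :\ s \subset S by apply: subsetDl.
have gB y z : y \in cycles_on S r.+1 -> z \in cycles_on (S :\ s) r.+1 ->
    y - z \in bounds_on S r.+1 -> g (f y) = g z.
  move=> yS zS yz; have [fS fy] := fP y yS.
  apply/eqP; rewrite -subr_eq0 -link_functionalB //; apply/eqP.
  apply: link_functional_bounds => //; first exact: rpredB.
  have -> : f y - z = (y - z) - (y - f y) by rewrite opprB [RHS]addrC addrA subrK.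
  exact: rpredB.
exists (g \o f); split=> /= [y z yS zS|y yB|w a Uwa sw wS].
- have [fyS fy] := fP y yS; have [fzS fz] := fP z zS.
  rewrite (gB _ (f y - f z)); [exact: link_functionalB|exact: rpredB|exact: rpredB|].
  by rewrite opprD addrACA -opprD rpredB.
- have -> : g (f y) = g 0 by apply: gB; rewrite ?rpred0 ?subr0 ?bounds_cycles.
  exact: link_functional0.
- have [w' [k [Uw' sw' w'S H ->]]] := triples_off_vertex cS Uwa sw wS sS.
  have wC : triples w \in cycles_on S r.+1.
    apply: triples_cycles => //; first by move: Uwa; rewrite rcons_uniq => /andP[].
    by move=> v vw; apply: wS; rewrite mem_rcons inE vw orbT.
  have w'C : triples w' \in cycles_on (S :\ s) r.+1.
    by apply: triples_cycles => // v; rewrite w'S.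
  rewrite (gB _ (flip k (triples w'))) //; last by case: (k); rewrite /= ?rpredN.
  by case: k {H} => /=; rewrite /g ?link_functionalN // link_functional_triples.
Qed.

End Existence.

(** * Products of two triples and a spare vertex have order 3 *)

Section Torsion.
Variables (n p : nat).
Notation V := 'I_n.
Notation E := (complete_edge n).
Notation Ch := (grass E).
Variables (S Y : {set V}) (y : Ch).
Hypotheses (yC : y \in cycles_on Y p) (YS : Y \subset S).
Implicit Types (w : seq V).

Let admissible w := uniq w && all [in S :\: Y] w.

Let admissible_perm w w' : perm_eq w w' -> admissible w -> admissible w'.
Proof. by move=> P; rewrite /admissible (perm_uniq P) (perm_all _ P). Qed.

(* The lemmas below read: exchanging two of the seven vertices, the spare one [s]
   included, changes the sign of [F] modulo boundaries. *)
Let F a b c d e f := join_triple a b c (join_triple d e f y).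

Let F_swap a b c d e f : F a b c d e f = - F d e f a b c.
Proof. exact: join_triple_swap. Qed.

Let spare_facts a b c d e f s : admissible [:: a; b; c; d; e; f; s] ->
  [/\ join_triple d e f y \in cycles_on ([set d; e; f] :|: Y) p.+1,
      uniq [:: a; b; c; s], [disjoint [:: a; b; c; s] & [set d; e; f] :|: Y],
      {subset [:: a; b; c; s] <= S} & [set d; e; f] :|: Y \subset S].
Proof.
move=> /andP[U /allP A].
have P : perm_eq [:: a; b; c; d; e; f; s] ([:: a; b; c; s] ++ [:: d; e; f]).
  by rewrite (perm_cat2l [:: a; b; c] [:: d; e; f; s]) (perm_catC [:: d; e; f] [:: s]).
have := U; rewrite (perm_uniq P) cat_uniq => /and3P[U1 D U2].
have AS v : v \in [:: a; b; c; s] ++ [:: d; e; f] -> (v \in S) && (v \notin Y).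
  by rewrite -(perm_mem P) => /A; rewrite !inE andbC.
have AS1 v : v \in [:: a; b; c; s] -> (v \in S) && (v \notin Y).
  by move=> vw; apply: AS; rewrite mem_cat vw.
have AS2 v : v \in [:: d; e; f] -> (v \in S) && (v \notin Y).
  by move=> vw; apply: AS; rewrite mem_cat vw orbT.
have [/andP[dS dY] /andP[eS eY] /andP[fS fY]] :
  [/\ (d \in S) && (d \notin Y), (e \in S) && (e \notin Y) & (f \in S) && (f \notin Y)].
  by split; apply: AS2; rewrite !inE eqxx ?orbT.
have [[de df ef] _] := uniq3 U2.
split=> //.
- exact: join_triple_cycles yC de ef dY eY fY _.
- apply/pred0P => v /=; apply/negbTE/andP => -[vw]; rewrite in_setU => /orP[vd|vY].
    case/negP: D; apply/hasP; exists v => //.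
    by move: vd; rewrite !inE -orbA.
  by have /andP[_ /negP[]] := AS1 v vw.
- by move=> v /AS1/andP[].
- by rewrite !subUset !sub1set dS eS fS.
Qed.

(** Digits in these names are positions in the list [a b c d e f s]; [rotate] is a 4-cycle, also
    odd. *)
Let swap27 a b c d e f s : admissible [:: a; b; c; d; e; f; s] ->
  F a b c d e f + F a s c d e f \in bounds_on S p.+2.
Proof. by move=> /spare_facts[C U D S4 TS]; apply: spare_middle C U D S4 TS. Qed.

Let rotate a b c d e f s : admissible [:: a; b; c; d; e; f; s] ->
  F a b c d e f + F s a b d e f \in bounds_on S p.+2.
Proof. by move=> /spare_facts[C U D S4 TS]; apply: spare_end C U D S4 TS. Qed.

Let swap57 a b c d e f s : admissible [:: a; b; c; d; e; f; s] ->
  F a b c d e f + F a b c d s f \in bounds_on S p.+2.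
Proof.
move=> A; rewrite F_swap [F a b c d s f]F_swap -opprD rpredN; apply: swap27.
by apply: admissible_perm A; rewrite (perm_catCA [:: a; b; c] [:: d; e; f]).
Qed.

Let chain3 (x z u v : Ch) : x + z \in bounds_on S p.+2 -> z + u \in bounds_on S p.+2 ->
  u + v \in bounds_on S p.+2 -> x + v \in bounds_on S p.+2.
Proof.
move=> xz zu uv; have -> : x + v = (x + z) - (z + u) + (u + v).
  by rewrite addrKA addrA subrK.
by rewrite rpredD ?rpredB.
Qed.

(** (25) = (27)(57)(27): [b] is parked in the spare position. *)
Let swap25 a b c d e f s : admissible [:: a; b; c; d; e; f; s] ->
  F a b c d e f + F a e c d b f \in bounds_on S p.+2.
Proof.
move=> A.
have A1 := admissible_perm (perm_exchange b s [:: a] [:: c; d; e; f] [::]) A.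
have A2 := admissible_perm (perm_exchange e b [:: a; s; c; d] [:: f] [::]) A1.
exact: chain3 (swap27 A) (swap57 A1) (swap27 A2).
Qed.

(** Conjugates [swap25] by [rotate], which brings [a] to the second position. *)
Let swap15 a b c d e f s : admissible [:: a; b; c; d; e; f; s] ->
  F a b c d e f + F e b c d a f \in bounds_on S p.+2.
Proof.
move=> A.
have A1 : admissible [:: s; a; b; d; e; f; c].
  apply: admissible_perm A.
  apply: perm_trans (perm_exchange c s [:: a; b] [:: d; e; f] [::]) _.
  by rewrite (perm_catCA [:: a; b] [:: s]).
have A2 := admissible_perm (perm_exchange a e [::] [:: b; c; d] [:: f; s]) A.
apply: chain3 (rotate A) (swap25 A1) _; rewrite addrC; exact: rotate A2.
Qed.

(** (12) = (15)(25)(15): an exchange inside one triple passes through the middle of the other, which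
    is why two triples are needed. *)
Let swap12 a b c d e f s : admissible [:: a; b; c; d; e; f; s] ->
  F a b c d e f + F b a c d e f \in bounds_on S p.+2.
Proof.
move=> A.
have A1 := admissible_perm (perm_exchange a e [::] [:: b; c; d] [:: f; s]) A.
have A2 := admissible_perm (perm_exchange b a [:: e] [:: c; d] [:: f; s]) A1.
exact: chain3 (swap15 A) (swap25 A1) (swap15 A2).
Qed.

Let cyc a b c d e f s : admissible [:: a; b; c; d; e; f; s] ->
  F a b c d e f - F c a b d e f \in bounds_on S p.+2.
Proof. by move=> /swap12; rewrite {2}/F join_triple_rev. Qed.

Lemma triple_torsion a b c d e f s : uniq [:: a; b; c; d; e; f; s] ->
  all [in S :\: Y] [:: a; b; c; d; e; f; s] ->
  join_triple a b c (join_triple d e f y) *+ 3 \in bounds_on S p.+2.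
Proof.
move=> U A; rewrite -/(F a b c d e f).
have A0 : admissible [:: a; b; c; d; e; f; s] by apply/andP.
have A1 : admissible [:: c; a; b; d; e; f; s].
  by apply: admissible_perm A0; rewrite (perm_catCA [:: a; b] [:: c]).
have /eqP sum0 : F a b c d e f + F c a b d e f + F b c a d e f == 0.
  by rewrite /F /join_triple [X in X + _]addrC !subrKA subrr.
have -> : F a b c d e f *+ 3 = (F a b c d e f - F c a b d e f) +
    ((F a b c d e f - F c a b d e f) + (F c a b d e f - F b c a d e f)).
  have cb : F c a b d e f + F b c a d e f = - F a b c d e f.
    by apply/eqP; rewrite -addr_eq0 addrC addrA sum0.
  by rewrite subrKA addrACA -opprD cb opprK !mulrS mulr0n addr0 addrA.
by apply: rpredD (cyc A0) (rpredD (cyc A0) (cyc A1)).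
Qed.

End Torsion.

(** * Fundamental cycles of chessboard complexes *)

Lemma flip_sum k (A : zmodType) (J : Type) (r : seq J) (P : pred J) (F : J -> A) :
  flip k (\sum_(j <- r | P j) F j) = \sum_(j <- r | P j) flip k (F j).
Proof. by case: k => //=; rewrite sumrN. Qed.

Lemma raddf_flip k (A B : zmodType) (f : {additive A -> B}) (x : A) : f (flip k x) = flip k (f x).
Proof. by case: k => //=; rewrite raddfN. Qed.

Lemma flipN k (A : zmodType) (x : A) : flip k (- x) = flip (~~ k) x.
Proof. by case: k => //=; rewrite opprK. Qed.

Lemma oppr_flip k (A : zmodType) (x : A) : - flip k x = flip (~~ k) x.
Proof. by case: k => //=; rewrite opprK. Qed.

Lemma flip0 k (A : zmodType) : flip k (0 : A) = 0.
Proof. by case: k => //=; rewrite oppr0. Qed.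

Section CrossCycles.
Variable n : nat.
Notation V := 'I_n.
Notation E := (complete_edge n).
Notation Ch := (grass E).
Implicit Types (a b c d x u : V) (A C S T : {set V}) (y : Ch).

(** The rank of [c] in the ordered set [C] modulo 2: the column sign of a Laplace expansion. *)
Definition parity C c : bool := odd (\sum_(d in C) (d < c)%N).

Lemma parityD1 C c d : d \in C -> parity C c = (d < c)%N (+) parity (C :\ d) c.
Proof. by move=> dC; rewrite /parity (big_setD1 d) //= oddD oddb. Qed.

Lemma parity_self C c : parity (C :\ c) c = parity C c.
Proof.
have [cC|cC] := boolP (c \in C); first by rewrite (parityD1 c cC) ltnn.
by congr parity; apply/setP => d; rewrite in_setD1; case: eqP => // ->; rewrite (negPf cC).
Qed.

Lemma parity_swap C c d : c \in C -> d \in C -> c != d ->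
  parity C c (+) parity (C :\ c) d = ~~ (parity C d (+) parity (C :\ d) c).
Proof.
move=> cC dC cd; rewrite (parityD1 d cC) (parityD1 c dC) -(parity_self _ c) -[parity (C :\ c)
  d](parity_self _ d).
rewrite (setD1C d c) -addbA -addbA; have -> : (d < c)%N = ~~ (c < d)%N.
  by case: (ltngtP c d) => // e; rewrite (ord_inj e) eqxx in cd.
rewrite !parity_self.
by case: (c < d)%N; case: (parity _ c); case: (parity _ d).
Qed.

(* When #|C| = size R + 1, the fundamental cycle of the chessboard complex R x C, joined with
  [y]. *)
Fixpoint cross_cycle (R : seq V) C y : Ch :=
  if R is r :: R' then
    \sum_(c in C) flip (parity C c) (join_edge r c (cross_cycle R' (C :\ c) y))
  else y.

Lemma cross_cycle_is_zmod_morphism R C : zmod_morphism (cross_cycle R C).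
Proof.
move=> y z; elim: R C => //= r R IH C; rewrite -sumrB; apply: eq_bigr => c _.
by rewrite IH raddfB flipB.
Qed.
HB.instance Definition _ R C :=
  GRing.isZmodMorphism.Build Ch Ch (cross_cycle R C) (cross_cycle_is_zmod_morphism R C).

Lemma exchange_off (F : V -> V -> Ch) C :
  \sum_(c in C) \sum_(d in C :\ c) F c d = \sum_(d in C) \sum_(c in C :\ d) F c d.
Proof.
rewrite (exchange_big_dep (mem C)) /=; last by move=> c d _ /setD1P[].
apply: eq_bigr => d dC; apply: eq_bigl => c; rewrite !in_setD1 dC andbT andbC eq_sym.
by [].
Qed.

(** This sum is what remains of a chessboard cycle when the edge of its first row is deleted.
    Expanding along the next row and exchanging the two removed columns changes signs uniformly,
    down to two columns and no row, where the two terms cancel. *)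
Lemma cross_cycle_alt R C y : #|C| = (size R).+2 ->
  \sum_(c in C) flip (parity C c) (cross_cycle R (C :\ c) y) = 0.
Proof.
elim: R C => [|r R IH] C cC /=.
  have /cards2P[a [b [ab ->]]] : #|C| == 2%N by rewrite cC.
  have D1 : [set a; b] :\ a = [set b] by rewrite setU1K // inE.
  have D2 : [set a; b] :\ b = [set a] by rewrite setUC setU1K // inE eq_sym.
  rewrite big_setU1 ?inE //= big_set1 -(parity_self _ a) -(parity_self _ b) D1 D2 /parity
    !big_set1 !oddb.
  case: (ltngtP a b) => [||e] /=; rewrite ?addrN ?addNr //.
  by rewrite (ord_inj e) eqxx in ab.
under eq_bigr => c _ do rewrite flip_sum.
rewrite exchange_off big1 // => d dC.
transitivity (flip (~~ parity C d) (join_edge r d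
   (\sum_(c in C :\ d) flip (parity (C :\ d) c) (cross_cycle R (C :\ d :\ c) y)))).
  rewrite raddf_sum flip_sum; apply: eq_bigr => c /setD1P[cd cC'] /=.
  by rewrite flip_flip parity_swap // raddf_flip flip_flip (setD1C c d C) addNb.
by rewrite IH ?raddf0 ?flip0 //; move: cC; rewrite (cardsD1 d) dC => -[].
Qed.

(** Faces that lose the edge of the first row cancel by [cross_cycle_alt]; in the others the
    boundary passes one edge, so each row contributes a sign. *)
Lemma bound_cross_cycle R C y : #|C| = (size R).+1 -> (forall r, r \in R -> r \notin C) ->
  bound (cross_cycle R C y) = flip (odd (size R)) (cross_cycle R C (bound y)).
Proof.
elim: R C => //= r R IH C cC RC; rewrite raddf_sum /=.
transitivity (\sum_(c in C) flip (parity C c) (cross_cycle R (C :\ c) y)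
   - \sum_(c in C) flip (parity C c) (join_edge r c (bound (cross_cycle R (C :\ c) y)))).
  rewrite -sumrB; apply: eq_bigr => c cC' /=; rewrite raddf_flip -flipB /=; congr flip.
  by rewrite bound_join //; apply: contraNneq (RC r (mem_head _ _)) => ->.
rewrite cross_cycle_alt // sub0r -sumrN flip_sum; apply: eq_bigr => c cC' /=.
rewrite IH; first by rewrite [join_edge r c (flip _ _)]raddf_flip /= !flip_flip oppr_flip addNb
  addbC.
  by move: cC; rewrite (cardsD1 c) cC' => -[].
by move=> d dR; rewrite in_setD1 negb_and RC ?orbT // inE dR orbT.
Qed.

Lemma cross_cycle_chains R C Y p S y : y \in chains_on Y p -> uniq R -> C \subset S -> Y \subset
  S ->
  {subset R <= S} -> (forall r, r \in R -> r \notin C /\ r \notin Y) -> [disjoint C & Y] ->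
  cross_cycle R C y \in chains_on S (size R + p).
Proof.
move=> yY; elim: R C S => [|r R IH] C S /=.
  by move=> _ _ YS _ _ _; apply: chains_on_sub yY.
move=> /andP[rR UR] CS YS RS Rout CY.
have [rC rY] := Rout r (mem_head _ _).
rewrite rpred_sum // => c cC; apply: rpred_flip.
have cY : c \notin Y by rewrite (disjointFr CY cC).
pose S' := [set x in R] :|: (C :\ c) :|: Y.
have cR : c \notin R by apply/negP => cR; have [] := Rout c; rewrite ?inE ?cR ?orbT // cC.
have H : cross_cycle R (C :\ c) y \in chains_on S' (size R + p).
  apply: IH => //.
  - by rewrite /S' -setUA setUCA subsetUl.
  - by rewrite subsetUr.
  - by move=> x xR; rewrite !inE xR.
  - move=> x xR; have [|xC xY] := Rout x; first by rewrite inE xR orbT.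
    by rewrite in_setD1 (negPf xC) andbF.
  - by apply: disjointWl CY; apply: subsetDl.
rewrite addSn; apply: join_chains H _ _ _.
- by rewrite !inE (negPf rR) (negPf rC) (negPf rY) andbF.
- by rewrite !inE eqxx (negPf cR) (negPf cY).
apply/subsetP => x; rewrite !inE => /or3P[/eqP->|/eqP->|/orP[/orP[xR|/andP[_ xC]]|xY]].
- by apply: RS; rewrite mem_head.
- exact: (subsetP CS).
- by apply: RS; rewrite inE xR orbT.
- exact: (subsetP CS).
- exact: (subsetP YS).
Qed.

Lemma link_cross_out x u R C y : link_edge x u y = 0 ->
  ~~ ((x \in R) && (u \in C)) -> ~~ ((u \in R) && (x \in C)) ->
  link_edge x u (cross_cycle R C y) = 0.
Proof.
move=> y0; elim: R C => //= r R IH C xu ux; rewrite raddf_sum big1 // => c cC.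
rewrite /= raddf_flip /= link_edge_join.
  rewrite IH ?raddf0 ?oppr0 ?flip0 //.
    by apply: contra xu => /andP[xR /setD1P[_ ->]]; rewrite inE xR orbT.
  by apply: contra ux => /andP[xR /setD1P[_ ->]]; rewrite inE xR orbT.
apply/negP => /eqP/setP e.
have := e x; have := e u; rewrite !inE !eqxx !orbT => /esym/orP[]/eqP eu /esym/orP[]/eqP ex.
- by have := e c; rewrite !inE eqxx orbT ex eu orbb => /eqP cr; case/negP: xu;
  rewrite inE ex eqxx eu -cr cC.
- by case/negP: ux; rewrite eu ex cC inE eqxx.
- by case/negP: xu; rewrite eu ex cC inE eqxx.
- have := e r; rewrite !inE eqxx ex eu orbb => /eqP rc.
  by case/negP: xu; rewrite ex eu cC inE rc eqxx.
Qed.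

(** The position of [x] in [R] leaves no trace in the sign: each earlier row costs one sign for
    passing its edge and one for exchanging the two removed columns. *)
Lemma link_cross_in x u R C y : link_edge x u y = 0 -> uniq R ->
  (forall r, r \in R -> r \notin C) -> x \in R -> u \in C ->
  link_edge x u (cross_cycle R C y) = flip (parity C u) (cross_cycle (rem x R) (C :\ u) y).
Proof.
move=> y0; elim: R C => //= r R IH C /andP[rR UR] RC; rewrite inE => xR uC.
have uR : u \notin R by apply: contraL uC => uR; apply: RC; rewrite inE uR orbT.
have ur : u != r by apply: contraTneq uC => ->; apply: RC; rewrite mem_head.
have xu : x != u.
  by apply: contraTneq uC => <-; apply: RC; rewrite inE.
have out c : ~~ ((x \in R) && (u \in C :\ c)) ->
    link_edge x u (cross_cycle R (C :\ c) y) = 0.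
  by move=> H; apply: link_cross_out => //; rewrite (negPf uR).
rewrite raddf_sum /=.
have [xr|xr] := eqVneq x r.
  rewrite (bigD1 u) //= big1 ?addr0 => [|c /andP[cC cu]].
    have xR' : x \notin R by rewrite xr.
    by rewrite raddf_flip /= -xr link_edge_join_id // out ?raddf0 ?addr0 // (negPf xR').
  rewrite raddf_flip /= link_edge_join.
    by rewrite out ?raddf0 ?oppr0 ?flip0 // xr (negPf rR).
  apply: contraNneq cu => /setP/(_ c); rewrite !inE eqxx orbT => /orP[/eqP cr|/eqP->//].
  by move: cC; rewrite cr xr (negPf (RC r (mem_head _ _))).
rewrite (negPf xr) /= in xR.
rewrite (bigD1 u) //= raddf_flip /= link_edge_join; last first.
  apply: contraNneq xr => /setP/(_ x); rewrite !inE eqxx (negPf xu) /= orbF.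
  by move/esym.
rewrite out ?raddf0 ?oppr0 ?flip0 ?add0r; last by rewrite setD11 andbF.
rewrite flip_sum (eq_bigl (mem (C :\ u))); last by move=> c; rewrite /= in_setD1 andbC.
apply: eq_bigr => c /setD1P[cu cC]; rewrite raddf_flip /= link_edge_join; last first.
  apply: contraNneq xr => /setP/(_ x); rewrite !inE eqxx /= => /esym/orP[->//|/eqP xc].
  by move: cC; rewrite -xc (negPf (RC x _)) // inE xR orbT.
rewrite IH //; last 2 first.
- by move=> d dR; rewrite in_setD1 negb_and RC ?orbT // inE dR orbT.
- by rewrite in_setD1 eq_sym cu.
rewrite raddf_flip /= flipN flip_flip flip_flip setD1C.
by rewrite addNb (@parity_swap C u c) // eq_sym.
Qed.

End CrossCycles.

(** * Links of combinations of chessboard cycles *)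

Section CrossCombinations.
Variable n : nat.
Notation V := 'I_n.
Notation E := (complete_edge n).
Notation Ch := (grass E).
Implicit Types (a b c d x u s : V) (A C R S T : {set V}) (y : Ch) (f : {set V} -> int).

Definition cross_comb A q f y : Ch :=
  \sum_(R : {set V} | (R \subset A) && (#|R| == q)) cross_cycle (enum R) (A :\: R) y *~ f R.

(* Only the R separating [x] from [u] contribute to the link of the edge [x u]. *)
Definition contract_coef A x u f R : int :=
  flip (parity ((A :\ x :\ u) :\: R) u) (f (x |: R)) +
  flip (parity ((A :\ x :\ u) :\: R) x) (f (u |: R)).

Lemma enumD1 R x : rem x (enum R) = enum (R :\ x).
Proof.
rewrite rem_filter ?enum_uniq // /enum_mem -filter_predI; apply: eq_filter => y.
by rewrite /= !inE.
Qed.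

Lemma mulz_flip (A : zmodType) k (z : A) (m : int) : flip k z *~ m = z *~ flip k m.
Proof. by case: k => //=; rewrite mulNrz mulrNz. Qed.

Lemma sum_insert A x u q (F : {set V} -> Ch) : x \in A -> u \in A -> x != u ->
  \sum_(R : {set V} | [&& R \subset A, #|R| == q.+1, x \in R & u \notin R]) F R =
  \sum_(R : {set V} | (R \subset A :\ x :\ u) && (#|R| == q)) F (x |: R).
Proof.
move=> xA uA xu; rewrite (reindex_onto (fun R => x |: R) (fun R => R :\ x)) /=; last first.
  by move=> R /and4P[_ _ xR _]; rewrite setD1K.
apply: eq_bigl => R; rewrite setU11 /= in_setU1 [u == x]eq_sym negb_or xu /= subUset sub1set xA /=.
have [xR|xR] := boolP (x \in R).
  rewrite !subsetD1 xR !andbF /= -andbA; apply/negbTE; rewrite !negb_and; apply/or3P/Or33.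
  by apply: contraTneq xR => <-; rewrite setD11.
by rewrite setU1K // eqxx andbT cardsU1 xR eqSS !subsetD1 xR andbT -!andbA [_ && (u \notin R)]andbC.
Qed.

(** Subsets containing both or neither of [x] and [u] do not have this edge on their board. The
    others reduce to the same family on [A] without [x] and [u], which allows induction. *)
Lemma link_cross_comb A q f y x u : x \in A -> u \in A -> x != u -> link_edge x u y = 0 ->
  link_edge x u (cross_comb A q.+1 f y) =
  cross_comb (A :\ x :\ u) q (contract_coef A x u f) y.
Proof.
move=> xA uA xu y0; rewrite /cross_comb raddf_sum /=.
pose G x u R := cross_cycle (enum R) ((A :\ x :\ u) :\: R) y *~
  flip (parity ((A :\ x :\ u) :\: R) u) (f (x |: R)).
have key a b : a \in A -> b \in A -> a != b -> link_edge a b y = 0 ->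
    \sum_(R : {set V} | [&& R \subset A, #|R| == q.+1, a \in R & b \notin R])
       link_edge a b (cross_cycle (enum R) (A :\: R) y *~ f R) =
    \sum_(R : {set V} | (R \subset A :\ a :\ b) && (#|R| == q)) G a b R.
  move=> aA bA ab y0'; rewrite sum_insert //; apply: eq_bigr => R /andP[RA _].
  rewrite raddfMz /= link_cross_in ?enum_uniq ?mem_enum ?setU11 //; last first.
  - rewrite !inE negb_or eq_sym ab bA andbT.
    by apply/negP => /(subsetP RA); rewrite !inE eqxx.
  - by move=> r; rewrite mem_enum !inE => ->.
  have aR : a \notin R by apply/negP => /(subsetP RA); rewrite !inE eqxx andbF.
  rewrite enumD1 setU1K // mulz_flip /G.
  have -> : A :\: (a |: R) :\ b = A :\ a :\ b :\: R.
    by apply/setP => d; rewrite !inE; case: (d == a); case: (d == b); case: (d \in R).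
  by rewrite -parity_self; congr (_ *~ flip (parity _ b) _); apply/setP => d; rewrite !inE;
     case: (d == a); case: (d == b); case: (d \in R).
rewrite (bigID (fun R => x \in R)) /=.
rewrite (bigID (fun R => u \in R)) /= big1 ?add0r; last first.
  move=> R /andP[/andP[/andP[RA _] xR] uR]; rewrite raddfMz /= link_cross_out ?mul0rz //.
    by rewrite !inE uR andbF.
  by rewrite !inE xR andbF.
rewrite [X in _ + X](bigID (fun R => u \in R)) /= [X in _ + (_ + X)]big1 ?addr0; last first.
  move=> R /andP[/andP[/andP[RA _] xR] uR]; rewrite raddfMz /= link_cross_out ?mul0rz //.
    by rewrite mem_enum (negPf xR).
  by rewrite mem_enum (negPf uR).
rewrite (eq_bigl (fun R : {set V} => [&& R \subset A, #|R| == q.+1, x \in R & u \notin R]));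
  last first.
  by move=> R; rewrite -!andbA.
rewrite [X in _ + X](eq_bigl (fun R : {set V} => [&& R \subset A, #|R| == q.+1, u \in R & x
  \notin R])); last first.
  by move=> R; rewrite -!andbA [(x \notin R) && _]andbC.
rewrite key // [X in _ + X](eq_bigr (fun R => link_edge u x (cross_cycle (enum R) (A :\: R) y *~
  f R))); last first.
  by move=> R _; rewrite link_edgeC.
rewrite key // 1?eq_sym // 1?link_edgeC // (setD1C u x A) -big_split; apply: eq_bigr => R _ /=.
by rewrite /G (setD1C u x A) -mulrzDr.
Qed.

End CrossCombinations.

Lemma flip_intr k (m : int) : (flip k m)%:~R = flip k (m%:~R) :> 'Z_3.
Proof. by case: k => //=; rewrite mulrNz. Qed.

(** Three quantities that cancel pairwise vanish, as 2 is invertible modulo 3. *)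
Lemma three_terms i j k (u v w : 'Z_3) : flip i u + flip j v = 0 -> flip i u + flip k w = 0 ->
  flip k w + flip j v = 0 -> u = 0.
Proof.
move=> /eqP; rewrite addr_eq0 => /eqP ev /eqP; rewrite addr_eq0 => /eqP ew.
rewrite -[flip k w]opprK -ew -[flip j v]opprK -ev -opprD Z3_opp_double.
by case: i {ev ew} => //= /eqP; rewrite oppr_eq0 => /eqP.
Qed.

(** * Independence modulo 3 of the chessboard classes *)

Section CrossIndependence.
Variable n : nat.
Notation V := 'I_n.
Notation E := (complete_edge n).
Notation Ch := (grass E).
Implicit Types (a b c d x u s : V) (A C R S T : {set V}) (y : Ch) (f : {set V} -> int).

Lemma goodMz r S g y (m : int) : good r S g -> y \in cycles_on S r -> g (y *~ m) = g y *~ m.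
Proof.
move=> gg yS; have Hn k : g (y *+ k) = g y *+ k.
  elim: k => [|k IH]; first by rewrite (good0 gg).
  by rewrite !mulrS (goodD gg) ?IH // rpredMn.
case: m => k; first exact: Hn.
by rewrite NegzE !mulrNz (goodN gg) ?rpredMn // -!pmulrn Hn.
Qed.

Lemma link_bounds S p x u y : y \in bounds_on S p.+1 ->
  link_edge x u y \in bounds_on (S :\ x :\ u) p.
Proof.
move=> /bounds_onP[b bS <-]; apply/bounds_onP; exists (- link_edge x u b).
  by rewrite rpredN link_chains.
by rewrite raddfN /= bound_link opprK.
Qed.

(** The cycle of the board with row [x] and columns [a], [b] is a triple with [x] in the middle; [k]
    records the order of [a] and [b]. *)
Lemma cross_comb_triple A f y x a b : uniq [:: x; a; b] -> A = [set x; a; b] ->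
  f [set a] = 0 -> f [set b] = 0 ->
  exists k, cross_comb A 1 f y = flip k (join_triple a x b y) *~ f [set x].
Proof.
move=> U AE fa fb; have [[xa xb ab] _] := uniq3 U.
have AD : A :\: [set x] = [set a; b].
  apply/setP => d; rewrite AE !inE; have [->|] := eqVneq d x; last by [].
  by rewrite (negPf xa) (negPf xb).
have D1 : [set a; b] :\ a = [set b] by rewrite setU1K // inE.
have D2 : [set a; b] :\ b = [set a] by rewrite setUC setU1K // inE eq_sym.
exists (b < a)%N; rewrite /cross_comb (bigD1 [set x]) /=; last first.
  by rewrite cards1 eqxx andbT sub1set AE !inE eqxx.
rewrite big1 ?addr0 => [|R /andP[/andP[RA /cards1P[v Rv]] Rx]]; last first.
  move: RA; rewrite Rv sub1set AE !inE => /orP[/orP[]|] /eqP vE; move: Rx; rewrite Rv vE ?eqxx //.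
    by rewrite fa.
  by rewrite fb.
rewrite enum_set1 AD /= big_setU1 ?inE //= big_set1.
rewrite -(parity_self _ a) -(parity_self _ b) D1 D2 /parity !big_set1 !oddb /join_triple.
rewrite (join_edgeC a x); case: (ltngtP a b) => [||e] /=; last by rewrite (ord_inj e) eqxx in ab.
  by [].
by rewrite opprB addrC.
Qed.

(** Links of edges avoiding [a] and [b] lower [q] and preserve the vanishing of [f] on subsets that
    meet these two vertices. At the end one subset is left, giving a product of r+1 triples with
    spare vertex [s], on which the functional is a sign. *)
Lemma cross_comb_independent q r A (w : seq V) s f a b : #|A| = (2 * q.+1).+1 ->
  a \in A -> b \in A -> a != b -> uniq (rcons w s) -> size w = (3 * r)%N ->
  (forall v, v \in rcons w s -> v \notin A) ->
  (forall R, (a \in R) || (b \in R) -> f R = 0) ->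
  cross_comb A q.+1 f (triples w) \in bounds_on (A :|: [set v in rcons w s]) (q.+1 + r) ->
  forall R, R \subset A -> #|R| = q.+1 -> (f R)%:~R = 0 :> 'Z_3.
Proof.
elim: q A f => [|q IH] A f cA aA bA ab Uws sw wA f0 fB R RA cR.
  have /cards1P[x xE] : #|A :\ a :\ b| == 1%N.
    move: cA; rewrite (cardsD1 a) aA (cardsD1 b (A :\ a)) in_setD1 bA eq_sym ab.
    by move: #|_| => m; clear; lia.
  have /setD1P[xb /setD1P[xa xA]] : x \in A :\ a :\ b by rewrite xE set11.
  have AE : A = [set x; a; b].
    rewrite -(setD1K aA) -(setD1K (_ : b \in A :\ a)) ?in_setD1 ?bA 1?eq_sym ?ab // xE.
    by apply/setP => d; rewrite !inE; case: (d == a); case: (d == b); case: (d == x).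
  have U3 : uniq [:: x; a; b] by rewrite /= !inE negb_or xa xb ab.
  have /cards1P[v Rv] : #|R| == 1%N by rewrite cR.
  have [vx|vx] := eqVneq v x; last first.
    move: RA; rewrite Rv sub1set AE !inE (negPf vx) /= => /orP[]/eqP->;
      by rewrite f0 // !inE eqxx ?orbT.
  have [||k Ek] := cross_comb_triple (triples w) U3 AE (f := f);
    try by rewrite f0 // !inE eqxx ?orbT.
  rewrite Rv vx; pose S := A :|: [set v in rcons w s].
  have [g gP] : exists g : Ch -> 'Z_3, good r.+1 S g.
    apply: good_exists; rewrite cardsU cA cardsE (card_uniqP Uws) size_rcons sw.
    rewrite (_ : A :&: _ = set0) ?cards0; first by rewrite subn0 (mulnS 3) addnS.
    apply/setP => d; rewrite !inE; apply/negP => /andP[dA dw].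
    by have := wA d dw; rewrite dA.
  have Ug : uniq (rcons [:: a, x, b & w] s).
    rewrite -[rcons _ s]/([:: a; x; b] ++ rcons w s) cat_uniq Uws andbT.
    rewrite -(perm_uniq (perm_exchange x a [::] [::] [:: b])) U3 /=.
    by apply/hasPn => v' /wA; rewrite AE !inE; case: (v' == a); case: (v' == x); case: (v' == b).
  have Sg : {subset rcons [:: a, x, b & w] s <= S}.
    move=> v'; rewrite -[rcons _ s]/([:: a; x; b] ++ rcons w s) mem_cat !inE.
    by case/orP => [/or3P[]/eqP->|->]; rewrite ?aA ?xA ?bA ?orbT.
  have T3 : triples [:: a, x, b & w] \in cycles_on S r.+1.
    apply: triples_cycles; first by rewrite /= sw mulnS.
      by move: Ug; rewrite rcons_uniq => /andP[].
    by move=> v' v'w; apply: Sg; rewrite mem_rcons inE v'w orbT.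
  have [_ g0 gT] := gP; have := g0 _ fB; rewrite Ek.
  have -> : join_triple a x b (triples w) = triples [:: a, x, b & w] by [].
  rewrite (goodMz _ gP) ?rpred_flip // (good_flip _ gP) // (gT _ s) //; last first.
    by rewrite /= sw mulnS.
  set e := sgn _ => H; have {H} : e *~ f [set x] = 0.
    by case: k {Ek} H => //= /eqP; rewrite mulNrz oppr_eq0 => /eqP.
  by move/(congr1 (fun z : 'Z_3 => e * z)); rewrite mulr0 mulrzAr sgnK.
have Df x u : x \in A :\ a :\ b -> u \in A :\ a :\ b -> x != u ->
    forall R', R' \subset A :\ x :\ u -> #|R'| = q.+1 -> (contract_coef A x u f R')%:~R = 0 :> 'Z_3.
  move=> /setD1P[xb /setD1P[xa xA]] /setD1P[ub /setD1P[ua uA]] xu.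
  apply: IH => //.
  - move: cA; rewrite (cardsD1 x) xA (cardsD1 u (A :\ x)) in_setD1 uA eq_sym xu.
    by move: #|_| => m; clear; lia.
  - by rewrite !in_setD1 aA ![a == _]eq_sym xa ua.
  - by rewrite !in_setD1 bA ![b == _]eq_sym xb ub.
  - by move=> v vw; rewrite !in_setD1 (negPf (wA v vw)) !andbF.
  - by move=> R' abR; rewrite /contract_coef !f0 ?flip0 ?addr0 // !inE; case/orP: abR => ->;
    rewrite ?orbT.
  have xw : x \notin w by apply/negP => xw; have := wA x;
    rewrite mem_rcons inE xw orbT xA => /(_ isT).
  rewrite -link_cross_comb // ?triples_link_out //.
  apply: bounds_on_sub (link_bounds x u fB); apply/subsetP => v.
  by rewrite !in_setD1 !in_setU !in_setD1; case/and3P => -> -> ->.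
have [aR|aR] := boolP (a \in R); first by rewrite f0 ?aR.
have [bR|bR] := boolP (b \in R); first by rewrite f0 ?bR ?orbT.
have /card_gt1P[x [u [xR uR xu]]] : (1 < #|R|)%N by rewrite cR.
(* [A] has 2q+5 elements, and [R] with [a] and [b] has q+4. *)
have [d] : exists d, d \in A :\: (a |: (b |: R)).
  apply/card_gt0P; have := cardsID (a |: (b |: R)) A.
  have -> : A :&: (a |: (b |: R)) = a |: (b |: R).
    by apply/setIidPr; rewrite !subUset !sub1set aA bA RA.
  by rewrite !cardsU1 in_setU1 negb_or aR ab bR cR cA; move: #|_| => m; clear; lia.
rewrite !inE !negb_or => /andP[/and3P[da db dR] dA].
have RA' v : v \in R -> v \in A :\ a :\ b.
  move=> vR; rewrite !in_setD1 (subsetP RA) // andbT; apply/andP.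
  by split; [apply: contraNneq bR | apply: contraNneq aR] => <-.
have dA' : d \in A :\ a :\ b by rewrite !in_setD1 da db.
have xd : x != d by apply: contraNneq dR => <-.
have ud : u != d by apply: contraNneq dR => <-.
pose R0 := R :\ x :\ u.
have RE : R = x |: (u |: R0) by rewrite /R0 setD1C setUCA setD1K ?setD1K // in_setD1 xu xR.
have cR0 : #|R0| = q by move: cR;
  rewrite (cardsD1 x) xR (cardsD1 u (R :\ x)) in_setD1 uR eq_sym xu => -[].
have R0A v : v \in R0 -> [/\ v \in A, v != x, v != u & v != d].
  move=> /setD1P[vu /setD1P[vx vR]]; split => //; first exact: (subsetP RA).
  by apply: contraNneq dR => <-.
have xA := subsetP RA _ xR; have uA := subsetP RA _ uR.
have R0x : x \notin R0 by rewrite !in_setD1 eqxx andbF.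
have R0u : u \notin R0 by rewrite !in_setD1 eqxx.
have R0d : d \notin R0 by apply/negP => /R0A[_ _ _]; rewrite eqxx.
(* The links of [x u], [x d] and [u d] give three relations with the same column set [B]. A
   coefficient keeps its sign in both of its relations: the parity in [B] of the vertex among [x],
   [u], [d] that its subset omits. *)
pose B := A :\: (x |: (u |: (d |: R0))).
have sub z z' v : v \in A -> v != z -> v != z' -> z \notin R0 -> z' \notin R0 ->
    v |: R0 \subset A :\ z :\ z'.
  move=> vA vz vz' zR zR'; rewrite !subsetD1 subUset sub1set vA !in_setU1 !negb_or.
  rewrite ![_ == v]eq_sym vz vz' zR zR' !andbT /=.
  by apply/subsetP => t /R0A[].
have card1 v : v \notin R0 -> #|v |: R0| = q.+1 by move=> vR; rewrite cardsU1 vR cR0.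
have := Df x d (RA' x xR) dA' xd (u |: R0) _ (card1 u R0u).
have := Df u d (RA' u uR) dA' ud (x |: R0) _ (card1 x R0x).
have := Df x u (RA' x xR) (RA' u uR) xu (d |: R0) _ (card1 d R0d).
rewrite !sub // 1?eq_sym //.
have B1 : A :\ x :\ u :\: (d |: R0) = B.
  by apply/setP => t; rewrite !inE !negb_or; case: (t == x); case: (t == u); case: (t == d);
    case: (t \in R).
have B2 : A :\ u :\ d :\: (x |: R0) = B.
  by apply/setP => t; rewrite !inE !negb_or; case: (t == x); case: (t == u); case: (t == d);
    case: (t \in R).
have B3 : A :\ x :\ d :\: (u |: R0) = B.
  by apply/setP => t; rewrite !inE !negb_or; case: (t == x); case: (t == u); case: (t == d);
    case: (t \in R).
rewrite /contract_coef B1 B2 B3 -RE (setUCA [set u] [set x]) -RE.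
rewrite (setUCA [set x] [set d]) (setUCA [set u] [set d]).
move=> /(_ isT) E3 /(_ isT) E2 /(_ isT) E1; move: E1 E2 E3; rewrite !intrD !flip_intr.
exact: three_terms.
Qed.

End CrossIndependence.

(** * Homology classes *)

Section Subgroup.
Variables (A G : zmodType) (f : {additive A -> G}).

Definition image_of : {pred G} := fun y => `[< exists x, y = f x >].

Lemma image_of_zmod_closed : zmod_closed image_of.
Proof.
split=> [|_ _ /asboolP[x ->] /asboolP[y ->]]; apply/asboolP; first by exists 0; rewrite raddf0.
by exists (x - y); rewrite raddfB.
Qed.
HB.instance Definition _ := GRing.isZmodClosed.Build G image_of image_of_zmod_closed.

Lemma contains_image : injective f -> contains_subgroup_isomorphic_to G A.
Proof.
move=> f_inj; exists (image_of : zmodClosed G), f; split=> // y.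
by split=> [/asboolP|H]; last exact/asboolP.
Qed.

End Subgroup.

Section Z3Combinations.
Variables (m : nat) (G : zmodType) (x : 'I_m -> G).
Hypothesis x3 : forall i, x i *+ 3 = 0.

(** Each coefficient is coerced to its representative 0, 1 or 2; additivity rests on [x3]. *)
Definition z3_comb (v : 'rV['Z_3]_m) : G := \sum_i x i *+ v 0 i.

Lemma mulrn_mod3 i k : x i *+ (k %% 3) = x i *+ k.
Proof. by rewrite [in RHS](divn_eq k 3) mulrnDr mulnC mulrnA x3 mul0rn add0r. Qed.

Lemma z3_comb_is_zmod_morphism : zmod_morphism z3_comb.
Proof.
have addM u v : z3_comb (u + v) = z3_comb u + z3_comb v.
  rewrite -big_split; apply: eq_bigr => i _ /=.
  by rewrite mxE /= mulrn_mod3 mulrnDr.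
by move=> u v; apply: (addIr (z3_comb v)); rewrite -addM !subrK.
Qed.
HB.instance Definition _ :=
  GRing.isZmodMorphism.Build 'rV['Z_3]_m G z3_comb z3_comb_is_zmod_morphism.

Lemma contains_z3 :
  (forall a : 'I_m -> nat, \sum_i x i *+ a i = 0 -> forall i, (a i)%:R = 0 :> 'Z_3) ->
  contains_subgroup_isomorphic_to G 'rV['Z_3]_m.
Proof.
move=> indep; apply: (@contains_image _ _ z3_comb); apply: raddf_inj => v /indep v0.
by apply/rowP => i; rewrite mxE -[RHS](v0 i) natr_Zp.
Qed.

End Z3Combinations.

Section Quotients.
Variables (R : zmodType) (I : zmodClosed R).
Notation Q := (Quotient.quot I).

Lemma quot_piB (x y : R) : \pi_(Q)%qT (x - y) = \pi_(Q)%qT x - \pi_(Q)%qT y.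
Proof. exact: raddfB. Qed.

Lemma quot_pi_eq0 (x : R) : \pi_(Q)%qT x = 0 <-> x \in I.
Proof.
rewrite -[x in x \in I]subr0 Quotient.idealrBE.
have <- : \pi_(Q)%qT 0 = 0 by exact: raddf0.
by split=> [/eqP|/eqP].
Qed.

End Quotients.

Section Homology.
Variable n : nat.
Notation V := 'I_n.
Notation E := (complete_edge n).
Notation Ch := (grass E).
Notation K := (matching_complex n).
Implicit Types (p d : nat) (y z : Ch).

(** The dictionary between functions on all sets of edges and chains indexed by faces; a bijection
    on [chains_on setT p]. *)
Definition restrict p y : chain K p := [ffun t : face K p => y (val t)].

Lemma restrict_is_zmod_morphism p : zmod_morphism (@restrict p).
Proof. by move=> y z; apply/ffunP => t; rewrite !ffunE. Qed.
HB.instance Definition _ p :=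
  GRing.isZmodMorphism.Build Ch (chain K p) (@restrict p) (@restrict_is_zmod_morphism p).

Lemma face_of p (t : {set E}) : (t \in matchings n) && (#|t| == p) ->
  exists s : face K p, val s = t.
Proof. by move=> tP; exists (exist (fun t => (t \in faces K) && (#|t| == p)) t tP). Qed.

Lemma restrict_inj p y : y \in chains_on setT p -> restrict p y = 0 -> y = 0.
Proof.
move=> /chains_onP yS y0; apply/ffunP => t; rewrite ffunE; apply/eqP/negPn/negP => yt.
have [tM /eqP tp _] := yS t yt; have [|s sE] := @face_of p t; first by rewrite tM.
by move/ffunP/(_ s): y0; rewrite !ffunE sE => /eqP; apply/negP.
Qed.

Lemma restrict_onto p (c : chain K p) : exists2 y, y \in chains_on setT p & restrict p y = c.
Proof.
exists ([ffun t : {set E} => oapp (fun s : face K p => c s) 0 (insub t)] : Ch).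
  apply/chains_onP => t; rewrite ffunE; case: insubP => [s /andP[tM /eqP tp] _ _|] /=; last by [].
  by split=> //; apply: subsetT.
by apply/ffunP => s; rewrite !ffunE valK.
Qed.

Lemma boundary_restrict p y : y \in chains_on setT p.+1 ->
  boundary (restrict p.+1 y) = restrict p (bound y).
Proof.
move=> /chains_onP yS; apply/ffunP => t; rewrite !ffunE sum_ffunE.
transitivity (\sum_(s : {set E}) incidence (val t) s * y s).
  rewrite [RHS](bigID (fun s => (s \in matchings n) && (#|s| == p.+1))) /=.
  rewrite [X in _ = _ + X]big1 ?addr0 => [|s sP]; last first.
    have [->|/yS[sM sp _]] := eqVneq (y s) 0; first by rewrite mulr0.
    by rewrite sM sp eqxx in sP.
  rewrite [RHS](reindex_omap (val : face K p.+1 -> _) insub) /=; last first.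
    by move=> s sP; rewrite insubT.
  apply: eq_big => [s|s _]; last by rewrite ffunE.
  by rewrite valK eqxx andbT; apply/esym/(valP s).
under eq_bigr => s _ do rewrite mulr_suml.
rewrite (exchange_big_dep predT) //=; apply: eq_bigr => e _; rewrite ffunE.
case: ifP => [et|/negbT et].
  rewrite big_pred0 // => s; apply/negbTE/negP => /andP[_ /eqP st].
  by move: et; rewrite -st setD11.
rewrite (big_pred1 (e |: val t)) => [|s] /=.
  (* [incidence] counts inside the larger face and [contract] inside the smaller one; [e] itself is
     not counted, so the signs agree. *)
  by rewrite -[X in X * _]/(gsign e (e |: val t)) gsignU1.
apply/andP/eqP => [[es /eqP <-]|->]; first by rewrite setD1K.
by rewrite setU11 setU1K.
Qed.

(** Total thanks to the default 0, but meaningful only on cycles with [d.+1] edges. *)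
Definition homology_class d y : reduced_homology K d :=
  \pi_(reduced_homology K d)%qT (insubd (0 : cycle K d) (restrict d.+1 y)).

Lemma class_rep d y : y \in cycles_on setT d.+1 ->
  val (insubd (0 : cycle K d) (restrict d.+1 y)) = restrict d.+1 y.
Proof.
move=> /cycles_onP[yS y0]; rewrite val_insubd ifT //.
by apply/eqP; rewrite boundary_restrict // y0 raddf0.
Qed.

Lemma homology_classB d y z : y \in cycles_on setT d.+1 -> z \in cycles_on setT d.+1 ->
  homology_class d (y - z) = homology_class d y - homology_class d z.
Proof.
move=> yS zS; rewrite /homology_class.
have -> : insubd (0 : cycle K d) (restrict d.+1 (y - z)) =
    insubd (0 : cycle K d) (restrict d.+1 y) - insubd (0 : cycle K d) (restrict d.+1 z).
  apply: val_inj; rewrite class_rep ?rpredB // raddfB /=.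
  rewrite -[X in X - _](class_rep yS) -[X in _ - X = _](class_rep zS).
  exact: esym (raddfB _ _ _).
exact: (quot_piB (@boundaries _ K d : zmodClosed (cycle K d))).
Qed.

Lemma homology_class_eq0 d y : y \in cycles_on setT d.+1 ->
  homology_class d y = 0 <-> y \in bounds_on setT d.+1.
Proof.
move=> yC; have [yS _] := cycles_onP _ _ _ yC; rewrite /homology_class quot_pi_eq0.
split=> [/asboolP[c]|/bounds_onP[b bS by_]].
  rewrite class_rep //; have [b bS <-] := restrict_onto c.
  rewrite boundary_restrict // => e; apply/bounds_onP; exists b => //.
  apply/eqP; rewrite -subr_eq0; apply/eqP; apply: (@restrict_inj d.+1).
    by rewrite rpredB // bound_chains.
  by rewrite raddfB /= e subrr.
apply/asboolP; exists (restrict d.+2 b).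
by rewrite class_rep // boundary_restrict // by_.
Qed.

Lemma homology_class0 d : homology_class d 0 = 0.
Proof. by rewrite -[in LHS](subrr (0 : Ch)) homology_classB ?rpred0 // subrr. Qed.

Lemma homology_classD d y z : y \in cycles_on setT d.+1 -> z \in cycles_on setT d.+1 ->
  homology_class d (y + z) = homology_class d y + homology_class d z.
Proof.
move=> yC zC; have NzC : - z \in cycles_on setT d.+1 by rewrite rpredN.
have zN : homology_class d (- z) = - homology_class d z.
  by rewrite -[- z]sub0r homology_classB ?rpred0 // homology_class0 sub0r.
by have := homology_classB yC NzC; rewrite opprK zN opprK.
Qed.

Lemma homology_classMn d y k : y \in cycles_on setT d.+1 ->
  homology_class d (y *+ k) = homology_class d y *+ k.
Proof.
move=> yC; elim: k => [|k IH]; first exact: homology_class0.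
by rewrite !mulrSr -IH homology_classD ?rpredMn.
Qed.

Lemma homology_class_sum d (J : finType) (F : J -> Ch) :
  (forall j, F j \in cycles_on setT d.+1) ->
  homology_class d (\sum_j F j) = \sum_j homology_class d (F j).
Proof.
move=> FC; suff [] : homology_class d (\sum_j F j) = \sum_j homology_class d (F j) /\
   \sum_j F j \in cycles_on setT d.+1 by [].
elim/big_rec2: _ => [|j y z _ [<- zC]].
  by rewrite homology_class0 rpred0.
by rewrite homology_classD // rpredD.
Qed.

End Homology.

(** * The classes in homology, and the binomial bounds *)

Section ManyClasses.
Variables (n k r : nat).
Hypotheses (nE : n = (2 * k + 1 + 3 * r.+3)%N).
Notation V := 'I_n.
Notation E := (complete_edge n).
Notation Ch := (grass E).

Lemma vertex_partition : exists (A : {set V}) (w : seq V) s,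
  [/\ #|A| = (2 * k.+1).+1, size w = (3 * r.+2)%N, uniq (rcons w s),
      forall v, v \in rcons w s -> v \notin A & forall v, (v \in A) || (v \in rcons w s)].
Proof.
pose L := enum V; pose l := (2 * k.+1).+1.
have sL : size L = n by rewrite -cardE card_ord.
have UL : uniq L by apply: enum_uniq.
have UL2 := UL; rewrite -(cat_take_drop l L) cat_uniq in UL2.
have /and3P[U1 D U2] := UL2.
have sd : size (drop l L) = (3 * r.+2).+1 by rewrite size_drop sL nE /l; clear; lia.
case/lastP Ed : (drop l L) sd U2 D => [|w s] // sw U2 D.
exists [set v in take l L], w, s; split => //.
- rewrite cardsE (card_uniqP U1) size_takel // sL nE /l; clear; lia.
- by move: sw; rewrite size_rcons => -[].
- by move=> v vw; rewrite inE; apply: (hasPn D).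
- by move=> v; rewrite inE -Ed -mem_cat cat_take_drop mem_enum.
Qed.

Lemma triples_torsion (w : seq V) s : size w = (3 * r.+2)%N -> uniq (rcons w s) ->
  triples w *+ 3 \in bounds_on [set v in rcons w s] r.+2.
Proof.
rewrite 2!mulnS; case: w => [|a [|b [|c [|d [|e [|f w]]]]]] // [sw] U.
have P : perm_eq (rcons [:: a, b, c, d, e, f & w] s) ([:: a; b; c; d; e; f; s] ++ w).
  rewrite -cats1 (perm_cat2l [:: a; b; c; d; e; f] (w ++ [:: s]) ([:: s] ++ w)).
  by rewrite perm_catC.
have := U; rewrite (perm_uniq P) cat_uniq => /and3P[U1 D U2].
apply: (@triple_torsion n r _ [set v in w] _ _ _ a b c d e f s) => //.
- by apply: triples_cycles => // v; rewrite inE.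
- by apply/subsetP => v; rewrite !in_set (perm_mem P) mem_cat orbC => ->.
- apply/allP => v vs; rewrite /= in_setD !in_set (perm_mem P) mem_cat vs andbT.
  by apply: contra D => vw; apply/hasP; exists v.
Qed.

Lemma contains_powers m : (m <= 'C((2 * k).+1, k.+1))%N ->
  contains_subgroup_isomorphic_to
    (reduced_homology (matching_complex n) (k + r.+2)) 'rV['Z_3]_m.
Proof.
have [A [w [s [cA sw Uws wA cov]]]] := vertex_partition.
have /card_gt1P[a [b [aA bA ab]]] : (1 < #|A|)%N by rewrite cA; clear; lia.
(* The admissible row sets; [m] of them are selected through the enumeration of [P]. *)
pose P := [set R : {set V} | (R \subset A :\ a :\ b) && (#|R| == k.+1)].
have cP : #|P| = 'C((2 * k).+1, k.+1).
  rewrite cards_draws; congr 'C(_, _); move: cA.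
  rewrite (cardsD1 a) aA (cardsD1 b (A :\ a)) in_setD1 bA eq_sym ab.
  by move: #|_| => c; clear; lia.
move=> mP; pose R (i : 'I_m) := nth set0 (enum P) i.
have iP (i : 'I_m) : (i < size (enum P))%N by rewrite -cardE cP; apply: leq_trans mP.
have RP i : R i \in P by rewrite -mem_enum mem_nth.
have Rinj : injective R.
  by move=> i j /eqP; rewrite nth_uniq ?enum_uniq // => /eqP/ord_inj.
have RA i : R i \subset A :\ a :\ b by have := RP i; rewrite inE => /andP[].
have RA' i : R i \subset A.
  by apply: subset_trans (RA i) _; apply: subset_trans (subsetDl _ _) (subsetDl _ _).
have Rc i : #|R i| = k.+1 by have := RP i; rewrite inE => /andP[_ /eqP].
pose y i : Ch := cross_cycle (enum (R i)) (A :\: R i) (triples w).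
pose S : {set V} := [set v in rcons w s].
have Uw : uniq w by move: Uws; rewrite rcons_uniq => /andP[].
have AS : [disjoint A & S].
  by rewrite disjoint_sym; apply/pred0P => v; rewrite /= inE; apply/negP => /andP[/wA/negP].
have chain_ext i p T z : z \in chains_on T p -> T \subset S ->
    cross_cycle (enum (R i)) (A :\: R i) z \in chains_on setT (k.+1 + p).
  move=> zT TS; rewrite -(Rc i) cardE; apply: cross_cycle_chains zT _ _ _ _ _ _;
    rewrite ?enum_uniq ?subsetT //.
  - by move=> v _; rewrite in_setT.
  - move=> v; rewrite mem_enum => vR; rewrite in_setD vR; split=> //.
    apply: contraL (subsetP (RA' i) _ vR) => /(subsetP TS) vS; by rewrite (disjointFl AS vS).
  - by apply: disjointWl (subsetDl _ _) _; apply: disjointWr TS AS.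
have Csize i : #|A :\: R i| = (size (enum (R i))).+1.
  rewrite -cardE cardsD (setIidPr (RA' i)) cA Rc; clear; lia.
have Rout i v : v \in enum (R i) -> v \notin A :\: R i.
  by rewrite mem_enum in_setD => ->.
have wS : [set v in w] \subset S by apply/subsetP => v; rewrite !inE mem_rcons inE => ->;
  rewrite orbT.
have wC : triples w \in cycles_on [set v in w] r.+2 by apply: triples_cycles => // v; rewrite inE.
have [wCh w0] := cycles_onP _ _ _ wC.
have yC i : y i \in cycles_on setT (k + r.+2).+1.
  apply/cycles_onP; split; first exact: chain_ext wCh wS.
  by rewrite bound_cross_cycle // ?w0 ?raddf0 ?flip0 // => v; apply: Rout.
apply: (@contains_z3 m _ (fun i => homology_class (k + r.+2) (y i))) => [i|c /eqP].
  rewrite -homology_classMn //; apply/homology_class_eq0; first exact: rpredMn.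
  (* [B] fills three times the product. Its chessboard cycle fills three times the class, up to the
     sign the boundary picks up in passing the rows, which the [flip] undoes. *)
  have /bounds_onP[B BS BE] := triples_torsion sw Uws.
  apply/bounds_onP; exists (flip (odd (size (enum (R i)))) (cross_cycle (enum (R i)) (A :\: R i)
    B)).
    by apply: rpred_flip; have := chain_ext i _ _ _ BS (subxx _); rewrite addnS.
  rewrite raddf_flip /= bound_cross_cycle //; last by move=> v; apply: Rout.
  by rewrite flip_flip addbb /= BE raddfMn.
under eq_bigr => i _ do rewrite -homology_classMn //.
rewrite -homology_class_sum => [|i]; last exact: rpredMn.
move=> /eqP/homology_class_eq0 H i.
have SC : \sum_i y i *+ c i \in cycles_on setT (k + r.+2).+1.
  by apply: rpred_sum => j _; apply: rpredMn.
have {SC H} H := H SC.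
(* The coefficients extended by 0 to all subsets; in particular [f] vanishes on subsets meeting [a]
   or [b]. *)
pose f T : int := \sum_(j | R j == T) (c j)%:Z.
have fR j : f (R j) = c j.
  by rewrite /f (big_pred1 j) // => j' /=; rewrite (inj_eq Rinj).
rewrite -[LHS]/((c i)%:Z%:~R) -fR.
apply: (@cross_comb_independent n k r.+2 A w s f a b) => //.
  move=> T abT; rewrite /f big_pred0 // => j; apply/negbTE/eqP => RT.
  case/orP: abT; rewrite -RT => /(subsetP (RA j)); rewrite !in_setD1 eqxx ?andbF //.
have -> : cross_comb A k.+1 f (triples w) = \sum_j y j *+ c j.
  rewrite /cross_comb; under eq_bigr => T _ do rewrite /f mulrz_sumr.
  rewrite (exchange_big_dep predT) //=; apply: eq_bigr => j _.
  rewrite (big_pred1 (R j)) // => T /=.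
  have [->|TR] := eqVneq T (R j); first by rewrite RA' Rc !eqxx.
  by rewrite andbF.
have -> : A :|: [set v in rcons w s] = setT by apply/setP => v; rewrite !inE cov.
by rewrite addSn.
Qed.

End ManyClasses.

(** By Pascal's rule, binomials grow when the upper index increases, alone or together with the
    lower one. With h half of k+1, take h-1 steps of the first kind and k+1-h of the second. *)
Lemma half_binomial_le k : ('C(k + 1, (k + 1) %/ 2) <= 'C((2 * k).+1, k.+1))%N.
Proof.
have up i j p q : ('C(p, q) <= 'C(p + i + j, q + j))%N.
  have H1 : ('C(p, q) <= 'C(p + i, q))%N.
    elim: i => [|i IH]; first by rewrite addn0.
    by rewrite addnS; case: q IH => [|q] IH; rewrite ?bin0 // binS (leq_trans IH) ?leq_addr.
  apply: leq_trans H1 _; elim: j => [|j IH]; first by rewrite !addn0.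
  by rewrite !addnS binS (leq_trans IH) ?leq_addl.
(* For [k = 0] one has [h = 0], and [h - 1] would be truncated. *)
set h := ((k + 1) %/ 2)%N; case: (posnP k) => [k0|k0].
  by rewrite /h k0.
have hk : (0 < h)%N /\ (h <= k.+1)%N by rewrite /h; split; lia.
have := up (h - 1)%N (k.+1 - h)%N (k + 1)%N h.
have -> : (k + 1 + (h - 1) + (k.+1 - h) = (2 * k).+1)%N by move: hk; clear; lia.
by have -> : (h + (k.+1 - h) = k.+1)%N by move: hk; clear; lia.
Qed.

(* The degree k - 1 + r is written k + r - 1, since k - 1 would truncate to 0
   at k = 0; 'rV['Z_3]_m is (Z_3)^m. *)
Theorem theorem5p4 :
  (forall k r : nat, (4 <= r)%N ->
     contains_subgroup_isomorphic_to
       (reduced_homology (matching_complex (2 * k + 1 + 3 * r)%N) (k + r - 1)%N)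
       'rV['Z_3]_('C(2 * k, k)))
  /\
  (forall k : nat,
     contains_subgroup_isomorphic_to
       (reduced_homology (matching_complex (2 * k + 10)%N) (k + 2)%N)
       'rV['Z_3]_('C(k + 1, (k + 1) %/ 2)))
  /\
  (forall k r : nat, (3 <= r)%N ->
     exists x : reduced_homology (matching_complex (2 * k + 1 + 3 * r)%N)
                  (k + r - 1)%N,
       has_additive_order x 3).
Proof.
have main k r m : (3 <= r)%N -> (m <= 'C((2 * k).+1, k.+1))%N ->
    contains_subgroup_isomorphic_to
      (reduced_homology (matching_complex (2 * k + 1 + 3 * r)%N) (k + r - 1)%N) 'rV['Z_3]_m.
  case: r => [|[|[|r]]] // _ mC; have -> : (k + r.+3 - 1 = k + r.+2)%N by lia.
  exact: contains_powers.
split; [|split].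
(* 'C(2k, k) is one of the two Pascal summands of 'C(2k+1, k+1). *)
- by move=> k r r4; apply: main; [exact: ltnW|rewrite binS leq_addl].
- move=> k; have -> : (2 * k + 10 = 2 * k + 1 + 3 * 3)%N by lia.
  have -> : (k + 2 = k + 3 - 1)%N by lia.
  by apply: main => //; apply: half_binomial_le.
(* A single copy of Z/3 is enough; the image of its generator has order 3 by injectivity. *)
- move=> k r r3; have [|S [f [f_inj _]]] := main k r 1%N r3; first by rewrite bin_gt0; lia.
  exists (f (const_mx 1)); split=> //.
    rewrite -raddfMn /= (_ : const_mx 1 *+ 3 = 0) ?raddf0 //.
    by apply/rowP => i; rewrite mulmxnE !mxE; apply: val_inj.
  move=> j /andP[j0 j3] /eqP; rewrite -raddfMn /= raddf_eq0 // => /eqP/rowP/(_ 0).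
  by rewrite mulmxnE !mxE; case: j j0 j3 => [|[|[|]]].
Qed.
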